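(* There exist numerical constants $c_0,c_1,c_2>0$ such that the following holds. Let $\mathcal{G}$ be a closed subgroup of $\mathcal{O}(d)$, $G^*\in\mathcal{G}^n$, and $\alpha\ge1$ be arbitrary. Suppose that the measurement graph is an Erdős–Rényi random graph on $[n]$ with observation rate $p\in(0,1]$, and that $\{\Theta_{ij}:1\le i<j\le n\}$ are independent noise matrices in $\mathbb{R}^{d\times d}$ that are independent of the measurement graph and whose entries are i.i.d. sub-Gaussian random variables with parameter $\sigma>0$. If $p\ge\frac{c_0(\log n)^2}{n}$ and $\sigma\le\frac{c_1\sqrt{pn}}{\alpha d}$, then $$\Pr\left(\|D^{-1}\Delta\|\le\frac1{32}\ \text{ and }\ \|\Pi^n(G^*+2D^{-1}\Delta G^* )-G^*\|_F\le\frac{(\sqrt2-1)\sqrt n}{48\alpha}\right)\ge1-\frac{c_2}{n}.$$ If the sub-Gaussian entries of the $\Theta_{ij}$ are zero-mean Gaussian with standard deviation $\sigma>0$, then the same inequality holds under the weaker requirement $p\ge\frac{c_0\log n}{n}$ (in place of $p\ge\frac{c_0(\log n)^2}{n}$).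
   Context: $[n]=\{1,\dots,n\}$; $\mathcal{O}(d)$ is the group of $d\times d$ real orthogonal matrices; $\|\cdot\|$ and $\|\cdot\|_F$ are the operator and Frobenius norms. For an $nd\times nd$ (resp. $nd\times d$) matrix $Y$, $[Y]_{ij}$ (resp. $[Y]_i$) denotes its $d\times d$ blocks. $\mathcal{G}^n\subset\mathbb{R}^{nd\times d}$ is the set of $G$ with all blocks $[G]_i\in\mathcal{G}$; $G_i^*=[G^*]_i$. A random variable $\xi$ is sub-Gaussian with parameter $\sigma>0$ if $\mathbb{E}[\exp(\lambda\xi)]\le\exp(\lambda^2\sigma^2/2)$ for all $\lambda\in\mathbb{R}$. Erdős–Rényi with observation rate $p$: the edge indicators $\{w_{ij}:1\le i<j\le n\}$ are i.i.d. Bernoulli($p$). Put $w_{ji}=w_{ij}$, $w_{ii}=1$, $r_i=\sum_jw_{ij}$, $D=\mathrm{Diag}(r_1,\dots,r_n)\otimes I_d$. Additive noise model: for edges $(i,j)$, $i<j$, the observation is $C_{ij}=G_i^*{G_j^*}^\top+\Theta_{ij}$. The matrix $\Delta\in\mathbb{R}^{nd\times nd}$ of deviations is thus the symmetric matrix with blocks $[\Delta]_{ij}=w_{ij}\Theta_{ij}$ for $i<j$, $[\Delta]_{ij}=w_{ij}\Theta_{ji}^\top$ for $i>j$, and $[\Delta]_{ii}=\mathbf0$. $\Pi(X)\in\operatorname{argmin}_{Q\in\mathcal{G}}\|X-Q\|_F$ for $X\in\mathbb{R}^{d\times d}$ (any choice of minimizer), and $[\Pi^n(Y)]_i=\Pi([Y]_i)$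 for $Y\in\mathbb{R}^{nd\times d}$. *)

(* Defs.v *)
From HB Require Import structures.
From mathcomp Require Export all_boot all_order all_algebra.
From mathcomp Require Export all_classical all_reals all_analysis.
Export Order.TTheory GRing.Theory Num.Theory.
Export numFieldNormedType.Exports.

Set Implicit Arguments.
Unset Strict Implicit.
Unset Printing Implicit Defensive.

Local Open Scope classical_set_scope.
Local Open Scope ring_scope.

Section Norms.
Context {R : realType}.

(* The library norm `|A| on matrices is the entrywise maximum, so neither of
   the two norms below is available off the shelf. *)
Definition frobenius_norm {m n : nat} (A : 'M[R]_(m, n)) : R :=
  Num.sqrt (\sum_(i < m) \sum_(j < n) A i j ^+ 2).

(* On column vectors frobenius_norm is the Euclidean norm. *)
Definition operator_norm {m n : nat} (A : 'M[R]_(m, n)) : R :=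
  sup [set frobenius_norm (A *m x) | x in
        [set x : 'cV[R]_n | frobenius_norm x <= 1]].

End Norms.

Section OrthogonalGroup.
Context {R : realType} {d : nat}.

Definition orthogonal_group : set 'M[R]_d := [set Q | Q *m Q^T = 1%:M].

Record closed_subgroup (G : set 'M[R]_d) : Prop := ClosedSubgroup {
  closed_subgroup_orthogonal : G `<=` orthogonal_group;
  closed_subgroup_closed : closed G;
  closed_subgroup1 : G 1%:M;
  closed_subgroupM : forall A B, G A -> G B -> G (A *m B);
  closed_subgroupV : forall A, G A -> G (invmx A) }.

Definition is_projection (G : set 'M[R]_d) (Pi : 'M[R]_d -> 'M[R]_d) : Prop :=
  forall X, G (Pi X) /\
    forall Q, G Q -> frobenius_norm (X - Pi X) <= frobenius_norm (X - Q).

End OrthogonalGroup.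

(* nd x nd and nd x d matrices cut into d x d blocks are indexed by
   \sum_(i < n) d, as required by the block-matrix operations of matrix.v. *)
Section BlockMatrices.
Context {R : realType} {n d : nat}.

Definition block_square := 'M[R]_(\sum_(i < n) d, \sum_(j < n) d).
Definition block_column := 'M[R]_(\sum_(i < n) d, d).

Definition block (Y : block_column) (i : 'I_n) : 'M[R]_d :=
  submxcol (p_ := fun=> d) Y i.

Definition stacked (G : set 'M[R]_d) : set block_column :=
  [set Y | forall i, G (block Y i)].

Definition stacked_map (f : 'M[R]_d -> 'M[R]_d) (Y : block_column) :
    block_column :=
  \mxcol_(i < n) f (block Y i).

End BlockMatrices.
Arguments block_square : clear implicits.
Arguments block_column : clear implicits.

Section Independence.
Context {disp : measure_display} {T : measurableType disp} {R : realType}.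
Variable P : probability T R.

Definition mutual_indep {I : finType} (D : {set I}) (F : I -> set (set T)) :
    Prop :=
  forall (J : {set I}) (A : I -> set T), J \subset D ->
    (forall i, i \in J -> F i (A i)) ->
    P (\bigcap_(i in [set` J]) A i) = (\prod_(i in J) P (A i))%E.

Definition indep (F G : set (set T)) : Prop :=
  forall A B, F A -> G B -> P (A `&` B) = (P A * P B)%E.

(* Only measurable sets are tested: the value of a measure elsewhere is
   unspecified. *)
Definition has_law {disp'} {T' : measurableType disp'} (X : {RV P >-> T'})
    (mu : set T' -> \bar R) : Prop :=
  forall A, measurable A -> distribution P X A = mu A.

Definition sub_gaussian (X : {RV P >-> R}) (sigma : R) : Prop :=
  forall lambda : R,
    ('M_P X lambda <= (expR (lambda ^+ 2 * sigma ^+ 2 / 2))%:E)%E.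

(* P A >= x for an event A that need not be measurable: the inner measure of A
   is at least x. For measurable A this is P A >= x. *)
Definition probability_ge (A : set T) (x : R) : Prop :=
  exists2 E : set T, measurable E & E `<=` A /\ (x%:E <= P E)%E.

End Independence.

Definition sigma_gen {disp'} {T' : measurableType disp'} {T K : Type}
    (D : set K) (X : K -> T -> T') : set (set T) :=
  <<s \bigcup_(k in D) preimage_set_system setT (X k) measurable >>.

Section Model.
Context {disp : measure_display} {T : measurableType disp} {R : realType}.
Variable P : probability T R.
Context {n d : nat}.

Definition upper : {set 'I_n * 'I_n} := [set e : 'I_n * 'I_n | (e.1 < e.2)%N].

(* Only the variables with i < j are meaningful in w i j and Theta i j. *)
Variables (w : 'I_n -> 'I_n -> {RV P >-> bool})
  (Theta : 'I_n -> 'I_n -> 'I_d -> 'I_d -> {RV P >-> R}).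

Definition erdos_renyi (p : R) : Prop :=
  mutual_indep P upper
    (fun e => preimage_set_system setT (w e.1 e.2) measurable) /\
  (forall i j : 'I_n, (i < j)%N -> has_law (w i j) (bernoulli_prob p)).

Definition graph_sigma : set (set T) :=
  sigma_gen [set` upper] (fun e => w e.1 e.2 : T -> bool).

Definition noise_sigma (e : 'I_n * 'I_n) : set (set T) :=
  sigma_gen setT (fun kl : 'I_d * 'I_d => Theta e.1 e.2 kl.1 kl.2 : T -> R).

Definition all_noise_sigma : set (set T) :=
  <<s \bigcup_(e in [set` upper]) noise_sigma e >>.

(* The identical distribution of the entries is required within each matrix
   Theta i j, not across matrices. *)
Record sub_gaussian_noise (sigma : R) : Prop := SubGaussianNoise {
  noise_indep : mutual_indep P upper noise_sigma;
  noise_indep_graph : indep P all_noise_sigma graph_sigma;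
  noise_entries_indep : forall i j : 'I_n, (i < j)%N ->
    mutual_indep P [set: 'I_d * 'I_d]%SET
      (fun kl => preimage_set_system setT (Theta i j kl.1 kl.2) measurable);
  noise_entries_ident : forall i j : 'I_n, (i < j)%N ->
    forall k l k' l' : 'I_d,
      has_law (Theta i j k l) (distribution P (Theta i j k' l'));
  noise_entries_sub_gaussian : forall i j : 'I_n, (i < j)%N ->
    forall k l : 'I_d, sub_gaussian (Theta i j k l) sigma }.

Definition gaussian_noise (sigma : R) : Prop :=
  forall i j : 'I_n, (i < j)%N ->
    forall k l : 'I_d, has_law (Theta i j k l) (normal_prob 0 sigma).

Definition weight (t : T) (i j : 'I_n) : R :=
  if (i < j)%N then (w i j t)%:R
  else if (j < i)%N then (w j i t)%:R
  else 1.

Definition degree (t : T) (i : 'I_n) : R := \sum_(j < n) weight t i j.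

Definition degree_mx (t : T) : block_square R n d :=
  \mxdiag_(i < n) ((degree t i)%:M : 'M[R]_d).

Definition noise_mx (t : T) (i j : 'I_n) : 'M[R]_d :=
  \matrix_(k < d, l < d) Theta i j k l t.

Definition deviation (t : T) : block_square R n d :=
  \mxblock_(i < n, j < n)
    ((if (i < j)%N then weight t i j *: noise_mx t i j
      else if (j < i)%N then weight t i j *: (noise_mx t j i)^T
      else 0) : 'M[R]_d).

Definition scaled_deviation (t : T) : block_square R n d :=
  invmx (degree_mx t) *m deviation t.

End Model.

(* Main.v *)
(* For a fixed graph with degrees of order pn, and l a power of 2 of order dpn,
   E Tr Delta^l is a sum over closed walks of length l on nd vertices. A walk
   whose i-th undirected edge has multiplicity k_i contributes at most prod
   h(k_i)^k_i with h(1) = 0 (centering) and h(k) of order sigma sqrt k, and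
   this depends only on the shape of the walk. A new vertex of a walk has at
   most l choices in the graph, and at least l choices among 2l labels; so the
   sum is at most nd / 2l times the same sum over the complete graph on 2l
   labels. The latter is at most E Tr Y^l for a symmetric 2l x 2l matrix Y with
   independent centered sub-Gaussian entries all of whose higher moments are
   large enough, and a net argument gives E Tr Y^l <= (C sigma sqrt l)^l up to
   a factor 4l. Markov's inequality then bounds ||Delta|| by C sigma sqrt (dpn)
   with probability 1 - O(1/n), and Chernoff's inequality bounds the degrees
   from below and above once pn >= 8 ln n, which for n >= 3 either assumption
   on p implies; hence ||D^-1 Delta|| is at most a small multiple of 1 / (alpha
   sqrt d). Since ||D^-1 Delta G*||_F <= ||D^-1 Delta|| sqrt (nd) and Pi at
   most doubles the distance to a point of the group, the second estimate
   follows. *)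

Require Import Defs.
From mathcomp Require Import measurable_realfun ring lra zify.
Import HBNNSimple.

Set Implicit Arguments.
Unset Strict Implicit.
Unset Printing Implicit Defensive.

Local Open Scope ring_scope.

(** * Closed walks *)

Section Walks.
Context {R : realType}.

(** A union bound over a net of the sphere in dimension nd costs a factor exponential in nd; applied
    to Delta itself it would give only sigma sqrt (nd) and lose the gain from sparsity. The
    comparison moves the net to dimension 2l, where its size is exponential in l and turns into a
    constant after the l-th root. The order l is pinned from both sides. It must dominate the
    degrees of the graph on nd vertices, up to 4dpn, so that fresh labels never run out. It must
    stay below a constant times dpn, because sigma sqrt l is the bound that comes out. Such an l is
    far above log (nd), so the dimension factor of the trace and the 1/n of the failure probability
    are both absorbed by e^l. The comparison needs termwise domination of all moments at once, odd
    ones included, since the noise need not be symmetric. One law on a finite set provides it, so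
    expectations on that side are finite sums. The factor 1 / sqrt d in the target for ||D^-1
    Delta|| pays for ||G*||_F = sqrt (nd). *)

Fixpoint walk_sum {V : finType} (j : nat) (F : seq V -> R) (s : seq V) : R :=
  if j is j'.+1 then \sum_(y : V) walk_sum j' F (rcons s y) else F s.

Definition cyc {V : Type} (s : seq V) : seq (V * V) := zip s (rot 1 s).

Definition cyc_prod {V : Type} (A : V -> V -> R) (s : seq V) : R :=
  \prod_(e <- cyc s) A e.1 e.2.

Lemma walk_sum_le {V : finType} j (F G : seq V -> R) s :
  (forall s', size s' = (size s + j)%N -> F s' <= G s') ->
  walk_sum j F s <= walk_sum j G s.
Proof.
elim: j s => [|j IH] s FG /=; first by apply: FG; rewrite addn0.
by apply: ler_sum => y _; apply: IH => s' hs'; apply: FG; rewrite hs' size_rcons addSnnS.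
Qed.

Lemma walk_sum_ge0 {V : finType} j (F : seq V -> R) s :
  (forall s', 0 <= F s') -> 0 <= walk_sum j F s.
Proof. by move=> F0; elim: j s => [|j IH] s //=; apply: sumr_ge0. Qed.

Lemma walk_sumZ {V : finType} j (F : seq V -> R) c s :
  walk_sum j (fun s => c * F s) s = c * walk_sum j F s.
Proof.
elim: j s => [|j IH] s //=.
by rewrite mulr_sumr; apply: eq_bigr => y _; rewrite IH.
Qed.

Lemma zip_cons_rcons {V : Type} (x z : V) s :
  zip (x :: s) (rcons s z) = rcons (zip (x :: s) s) (last x s, z).
Proof. by elim: s x => [|y s IH] x //=; rewrite -IH. Qed.

Lemma cyc_cons {V : Type} (x : V) s :
  cyc (x :: s) = rcons (zip (x :: s) s) (last x s, x).
Proof. by rewrite /cyc rot1_cons zip_cons_rcons. Qed.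

Lemma zip_cons_rcons_path {V : Type} (x z : V) s :
  zip (x :: rcons s z) (rcons s z) = rcons (zip (x :: s) s) (last x s, z).
Proof. by elim: s x => [|y s IH] x //=; rewrite -IH. Qed.

(** Stated for an arbitrary prefix so that induction goes through: the [j] free vertices and the
    closing step make [j.+1] factors, whose sum is a matrix power leading from the last vertex back
    to [x]. *)
Lemma walk_sum_cyc_prod N (A : 'M[R]_N) j x s :
  walk_sum j (cyc_prod A) (x :: s) =
  (\prod_(e <- zip (x :: s) s) A e.1 e.2) * (A ^+ j.+1) (last x s) x.
Proof.
elim: j s => [|j IH] s.
  by rewrite /= /cyc_prod cyc_cons big_rcons expr1.
rewrite [A ^+ j.+2]exprS mxE mulr_sumr [LHS]/=; apply: eq_bigr => y _.
by rewrite -rcons_cons IH zip_cons_rcons_path big_rcons last_rcons mulrA.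
Qed.

Lemma trace_expr N (A : 'M[R]_N) j :
  \tr (A ^+ j.+1) = walk_sum j.+1 (cyc_prod A) [::].
Proof.
rewrite /mxtrace /=; apply: eq_bigr => x _.
by rewrite walk_sum_cyc_prod /= big_nil mul1r.
Qed.

(** The largest [a i], clipped at 0, separates all [a] from all [b], so no matching between the two
    index sets has to be chosen. *)
Lemma sum_le_card (I J : finType) (P : pred I) (Q : pred J) (a : I -> R) (b : J -> R) :
  (#|P| <= #|Q|)%N -> (forall j, Q j -> 0 <= b j) ->
  (forall i j, P i -> Q j -> a i <= b j) ->
  \sum_(i | P i) a i <= \sum_(j | Q j) b j.
Proof.
move=> PQ b0 ab; case: (pickP P) => [i0 Pi0|P0]; last first.
  by rewrite big_pred0 // sumr_ge0.
case: (arg_maxP a Pi0) => i Pi imax.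
have cb j : Q j -> Num.max 0 (a i) <= b j.
  by move=> Qj; rewrite ge_max b0 //= ab.
apply: (@le_trans _ _ (\sum_(k | P k) Num.max 0 (a i))).
  by apply: ler_sum => k Pk; rewrite le_max; apply/orP; right; exact: imax.
apply: (@le_trans _ _ (\sum_(j | Q j) Num.max 0 (a i))); last exact: ler_sum.
by rewrite !sumr_const ler_wpMn2l // le_max lexx.
Qed.

Lemma walk_sum_not_path (V : finType) (adj : rel V) (F : seq V -> R) j x s :
  (forall x s, ~~ path adj x s -> F (x :: s) = 0) ->
  ~~ path adj x s -> walk_sum j F (x :: s) = 0.
Proof.
move=> F0; elim: j s => [|j IH] s hs /=; first exact: F0.
by apply: big1 => y _; apply: IH; rewrite rcons_path negb_and hs.
Qed.

Section Compare.
Variables (V W : finType) (adj : rel V) (M l : nat).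
Variables (F : seq V -> R) (F' : seq W -> R).
Hypothesis degM : forall x, (#|adj x| <= M)%N.
Hypothesis cardW : (M + l <= #|W|)%N.
Hypothesis F'0 : forall s, 0 <= F' s.
Hypothesis F0 : forall x s, ~~ path adj x s -> F (x :: s) = 0.
Hypothesis FF' : forall s (phi : V -> W), {in s &, injective phi} ->
  F s <= F' (map phi s).

(* A fresh vertex of a walk has at most M values in the graph and at least M
   values among the labels of W not yet used; a repeated vertex has exactly one
   value on either side. *)
Lemma walk_sum_relabel j x s (phi : V -> W) :
  (size s + j <= l)%N -> {in x :: s &, injective phi} ->
  walk_sum j F (x :: s) <= walk_sum j F' (map phi (x :: s)).
Proof.
elim: j s phi => [|j IH] s phi hj inj_phi; first exact: FF'.
rewrite [leLHS]/= [leRHS]/=.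
set p := x :: s; set p' := map phi p.
rewrite (bigID (fun y => y \in p)) [leRHS](bigID (fun y => y \in p')) /=.
apply: lerD.
  have -> : \sum_(y | y \in p') walk_sum j F' (rcons p' y) =
            \sum_(y | y \in p) walk_sum j F' (rcons p' (phi y)).
    transitivity (\sum_(y in [set phi y | y in p]%SET) walk_sum j F' (rcons p' y)).
      apply: eq_bigl => y; apply/mapP/imsetP => -[z zp ->]; by exists z.
    by rewrite big_imset.
  apply: ler_sum => y yp; rewrite /p' -map_rcons.
  apply: (IH (rcons s y)); first by rewrite size_rcons; lia.
  have sub z : z \in x :: rcons s y -> z \in x :: s.
    by rewrite -rcons_cons mem_rcons inE => /orP[/eqP->|].
  by move=> u v /sub hu /sub hv; apply: inj_phi.
(* Fresh vertices that are not neighbours of the last one contribute 0, which leaves at most [M] of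
   them. *)
have -> : \sum_(y | y \notin p) walk_sum j F (rcons p y) =
    \sum_(y | (y \notin p) && adj (last x s) y) walk_sum j F (rcons p y).
  rewrite [LHS](bigID (adj (last x s))) /= [X in _ + X]big1 ?addr0 // => y /andP[_ ny].
  by rewrite (walk_sum_not_path _ F0) // rcons_path (negbTE ny) andbF.
apply: sum_le_card.
- apply: (@leq_trans M).
    apply: leq_trans (degM (last x s)); apply: subset_leq_card.
    by apply/fintype.subsetP => y; rewrite unfold_in => /andP[_].
  (* The image [p'] occupies at most [l] labels, so at least [M] labels of [W] are still free. *)
  have -> : #|(fun y => y \notin p')| = #|[predC p']| by apply: eq_card.
  have sp' : size p' = (size s).+1 by rewrite size_map.
  rewrite -(leq_add2l #|p'|) cardC (leq_trans _ cardW) // addnC leq_add2l.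
  by rewrite (leq_trans (card_size p')) // sp'; lia.
- by move=> y _; apply: walk_sum_ge0.
- move=> y y' /andP[yp _] y'p'.
  (* The value of [phi] at the fresh [y] is irrelevant so far and can be overwritten by [y']; since
     [y'] is a free label, injectivity on the longer walk survives. *)
  pose psi z := if z == y then y' else phi z.
  have psip : map psi p = p'.
    by apply/eq_in_map => z zp; rewrite /psi; case: eqP => // zy; move: yp; rewrite -zy zp.
  rewrite -[leRHS]/(walk_sum j F' (rcons p' y')).
  have -> : rcons p' y' = map psi (rcons p y).
    by rewrite map_rcons psip /psi eqxx.
  apply: (IH (rcons s y)); first by rewrite size_rcons; lia.
  have phiNy' z : z \in p -> phi z = y' -> False.
    by move=> zp e; move: y'p'; rewrite -e map_f.
  move=> u v; rewrite -rcons_cons !mem_rcons !inE => hu hv; rewrite /psi.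
  have [->|uy] := eqVneq u y; have [->|vy] := eqVneq v y => //.
  + by move=> e; case: (phiNy' v) => //; move: hv; rewrite (negbTE vy).
  + by move=> e; case: (phiNy' u) => //; move: hu; rewrite (negbTE uy).
  + by apply: inj_phi; [move: hu; rewrite (negbTE uy)|move: hv; rewrite (negbTE vy)].
Qed.

(** Every start in [V] is paired with every start in [W], the initial relabelling being the constant
    map; this is the origin of the crossed cardinalities. *)
Lemma walk_sum_compare :
  #|W|%:R * walk_sum l.+1 F [::] <= #|V|%:R * walk_sum l.+1 F' [::].
Proof.
rewrite /=.
have -> : #|W|%:R * \sum_x walk_sum l F [:: x] =
    \sum_(x : V) \sum_(y : W) walk_sum l F [:: x].
  rewrite mulr_sumr; apply: eq_bigr => x _.
  by rewrite sumr_const mulr_natl.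
rewrite mulr_natl -sumr_const; apply: ler_sum => x _; apply: ler_sum => y _.
apply: (@walk_sum_relabel l x [::] (fun=> y)) => //.
by move=> u v; rewrite !inE => /eqP-> /eqP->.
Qed.
End Compare.

Definition same_edge {V : eqType} (e f : V * V) :=
  (e == f) || (e == (f.2, f.1)).

(** The product runs over the steps, not over the distinct edges: an edge of multiplicity k
    contributes [h k ^+ k], so [h k] stands for the k-th root of a bound on a k-th moment. *)
Definition walk_weight {V : eqType} (h : nat -> R) (s : seq V) : R :=
  \prod_(e <- cyc s) h (count (same_edge e) (cyc s)).

Lemma cyc_map (V W : Type) (phi : V -> W) s :
  cyc (map phi s) = map (fun e => (phi e.1, phi e.2)) (cyc s).
Proof.
rewrite /cyc -map_rot; elim: s (rot 1 s) => [|x s IH] [|y t] //=.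
by rewrite IH.
Qed.

Lemma mem_cyc (V : eqType) (s : seq V) e :
  e \in cyc s -> (e.1 \in s) && (e.2 \in s).
Proof.
case: e => u v uv; rewrite /= -[v \in s](mem_rot 1).
have : u \in unzip1 (cyc s) by apply/mapP; exists (u, v).
have : v \in unzip2 (cyc s) by apply/mapP; exists (u, v).
by rewrite unzip1_zip ?unzip2_zip ?size_rot // => -> ->.
Qed.

(** The weight only depends on which vertices of the walk coincide, that is, on its shape. *)
Lemma walk_weight_map (V W : eqType) (h : nat -> R) (phi : V -> W) s :
  {in s &, injective phi} -> walk_weight h (map phi s) = walk_weight h s.
Proof.
move=> inj_phi; rewrite /walk_weight cyc_map big_map.
rewrite [LHS]big_seq [RHS]big_seq; apply: eq_bigr => e /mem_cyc/andP[e1 e2].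
congr (h _); rewrite count_map; apply: eq_in_count => f /mem_cyc/andP[f1 f2].
by rewrite /= /same_edge !xpair_eqE !(inj_in_eq inj_phi).
Qed.

End Walks.

(** * Frobenius and operator norms *)

Section MatrixNorms.
Context {R : realType}.

(** By Lagrange's identity the gap is half the double sum of the squares (a_i b_j - a_j b_i)^2. *)
Lemma cauchy_schwarz (I : finType) (a b : I -> R) :
  (\sum_i a i * b i) ^+ 2 <= (\sum_i a i ^+ 2) * (\sum_i b i ^+ 2).
Proof.
have : 0 <= \sum_i \sum_j (a i * b j - a j * b i) ^+ 2.
  by apply: sumr_ge0 => i _; apply: sumr_ge0 => j _; exact: sqr_ge0.
have -> : \sum_i \sum_j (a i * b j - a j * b i) ^+ 2 =
    2 * ((\sum_i a i ^+ 2) * (\sum_i b i ^+ 2)) - 2 * (\sum_i a i * b i) ^+ 2.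
  have E1 : (\sum_i a i ^+ 2) * (\sum_i b i ^+ 2) =
      \sum_i \sum_j a i ^+ 2 * b j ^+ 2.
    by rewrite mulr_suml; apply: eq_bigr => i _; rewrite mulr_sumr.
  have E2 : (\sum_i a i ^+ 2) * (\sum_i b i ^+ 2) =
      \sum_i \sum_j a j ^+ 2 * b i ^+ 2 by rewrite E1 exchange_big.
  have E3 : (\sum_i a i * b i) ^+ 2 = \sum_i \sum_j (a i * b i) * (a j * b j).
    by rewrite expr2 mulr_suml; apply: eq_bigr => i _; rewrite mulr_sumr.
  rewrite mulrDl mul1r {1}E1 E2 E3 -big_split /= mulr_sumr -sumrB.
  apply: eq_bigr => i _; rewrite -big_split /= mulr_sumr -sumrB.
  by apply: eq_bigr => j _; ring.
lra.
Qed.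

Lemma frobenius_norm_ge0 m n (A : 'M[R]_(m, n)) : 0 <= frobenius_norm A.
Proof. exact: sqrtr_ge0. Qed.

Lemma sqr_frobenius_norm m n (A : 'M[R]_(m, n)) :
  frobenius_norm A ^+ 2 = \sum_(i < m) \sum_(j < n) A i j ^+ 2.
Proof.
by rewrite sqr_sqrtr // sumr_ge0 // => i _; rewrite sumr_ge0 // => j _; exact: sqr_ge0.
Qed.

Lemma frobenius_norm_le m n m' n' (A : 'M[R]_(m, n)) (B : 'M[R]_(m', n')) (c : R) :
  0 <= c -> (frobenius_norm A <= c * frobenius_norm B) =
  (frobenius_norm A ^+ 2 <= c ^+ 2 * frobenius_norm B ^+ 2).
Proof.
by move=> c0; rewrite -exprMn ler_sqr // nnegrE ?mulr_ge0 // frobenius_norm_ge0.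
Qed.

Lemma frobenius_norm0 m n : frobenius_norm (0 : 'M[R]_(m, n)) = 0.
Proof.
apply/eqP; rewrite -sqrf_eq0 sqr_frobenius_norm big1 // => i _.
by rewrite big1 // => j _; rewrite mxE expr0n.
Qed.

Lemma frobenius_norm_eq0 m n (A : 'M[R]_(m, n)) : frobenius_norm A = 0 -> A = 0.
Proof.
move=> A0; have := sqr_frobenius_norm A; rewrite A0 expr0n /= => /esym/eqP.
rewrite psumr_eq0 => [/allP hA|i _]; last by apply: sumr_ge0 => j _; exact: sqr_ge0.
apply/matrixP => i j; have := hA i; rewrite mem_index_enum => /(_ isT) /=.
rewrite psumr_eq0 => [/allP hB|k _]; last exact: sqr_ge0.
by have := hB j; rewrite mem_index_enum sqrf_eq0 mxE => /(_ isT) /eqP.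
Qed.

Lemma frobenius_normZ m n (c : R) (A : 'M[R]_(m, n)) :
  frobenius_norm (c *: A) = `|c| * frobenius_norm A.
Proof.
rewrite /frobenius_norm -[`|c|]sqrtr_sqr -sqrtrM ?sqr_ge0 //; congr Num.sqrt.
rewrite mulr_sumr; apply: eq_bigr => i _; rewrite mulr_sumr.
by apply: eq_bigr => j _; rewrite mxE exprMn.
Qed.

Lemma frobenius_normN m n (A : 'M[R]_(m, n)) :
  frobenius_norm (- A) = frobenius_norm A.
Proof. by rewrite -scaleN1r frobenius_normZ normrN normr1 mul1r. Qed.

Lemma frobenius_normD m n (A B : 'M[R]_(m, n)) :
  frobenius_norm (A + B) <= frobenius_norm A + frobenius_norm B.
Proof.
rewrite -ler_sqr ?nnegrE ?addr_ge0 ?frobenius_norm_ge0 // sqrrD !sqr_frobenius_norm.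
rewrite !pair_bigA /=.
have -> : \sum_p (A + B) p.1 p.2 ^+ 2 = \sum_p A p.1 p.2 ^+ 2 +
    (\sum_p A p.1 p.2 * B p.1 p.2) *+ 2 + \sum_p B p.1 p.2 ^+ 2.
  rewrite -sumrMnl -!big_split /=; apply: eq_bigr => p _.
  by rewrite mxE sqrrD.
rewrite lerD2r lerD2l lerMn2r orFb -sqrtrM; last first.
  by rewrite sumr_ge0 // => i _; rewrite sumr_ge0 // => j _; exact: sqr_ge0.
rewrite !pair_bigA /= (le_trans (ler_norm _)) // -sqrtr_sqr ler_sqrt.
  exact: cauchy_schwarz.
by rewrite mulr_ge0 // sumr_ge0 // => p _; exact: sqr_ge0.
Qed.

Lemma frobenius_normM m n p (A : 'M[R]_(m, n)) (B : 'M[R]_(n, p)) :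
  frobenius_norm (A *m B) <= frobenius_norm A * frobenius_norm B.
Proof.
rewrite -ler_sqr ?nnegrE ?mulr_ge0 ?frobenius_norm_ge0 // exprMn !sqr_frobenius_norm.
rewrite mulr_suml; apply: ler_sum => i _.
rewrite [X in _ <= _ * X]exchange_big mulr_sumr; apply: ler_sum => j _.
by rewrite mxE; exact: cauchy_schwarz.
Qed.

Lemma sqr_frobenius_norm_cV n (x : 'cV[R]_n) :
  frobenius_norm x ^+ 2 = (x^T *m x) 0 0.
Proof.
rewrite sqr_frobenius_norm mxE; apply: eq_bigr => i _.
by rewrite big_ord1 !mxE expr2.
Qed.

Lemma sqr_frobenius_norm_tr n (A : 'M[R]_n) :
  frobenius_norm A ^+ 2 = \tr (A *m A^T).
Proof.
rewrite sqr_frobenius_norm /mxtrace; apply: eq_bigr => i _.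
by rewrite mxE; apply: eq_bigr => j _; rewrite mxE expr2.
Qed.

Lemma dot_le_frobenius n (x y : 'cV[R]_n) :
  (x^T *m y) 0 0 <= frobenius_norm x * frobenius_norm y.
Proof.
rewrite (le_trans (ler_norm _)) // -ler_sqr ?nnegrE ?mulr_ge0 ?frobenius_norm_ge0 //.
rewrite real_normK ?num_real // exprMn !sqr_frobenius_norm.
under [X in _ <= X * _]eq_bigr do rewrite big_ord1.
under [X in _ <= _ * X]eq_bigr do rewrite big_ord1.
rewrite mxE; under [X in X ^+ 2 <= _]eq_bigr do rewrite mxE.
exact: cauchy_schwarz.
Qed.

Lemma trmxX n (A : 'M[R]_n) k : A^T = A -> (A ^+ k)^T = A ^+ k.
Proof.
move=> AT; elim: k => [|k IH]; first by rewrite expr0 trmx1.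
by rewrite [in RHS]exprSr exprS trmx_mul AT IH.
Qed.

(** For symmetric B, |Bx|^2 = <x, B^2 x> <= |x| |B^2 x|. Repeated squaring replaces the spectral
    theorem, and this is why the exponents are powers of 2. *)
Lemma frobenius_norm_sym_expr n (A : 'M[R]_n) (x : 'cV[R]_n) a :
  A^T = A -> frobenius_norm x <= 1 ->
  frobenius_norm (A *m x) ^+ (2 ^ a) <= frobenius_norm (A ^+ (2 ^ a) *m x).
Proof.
move=> AT x1; elim: a => [|a IH]; first by rewrite expn0 !expr1.
rewrite expnS mulnC exprM; set B := A ^+ (2 ^ a).
apply: (@le_trans _ _ (frobenius_norm (B *m x) ^+ 2)).
  by rewrite lerXn2r ?nnegrE ?exprn_ge0 ?frobenius_norm_ge0.
have -> : A ^+ (2 ^ a * 2) = B *m B by rewrite muln2 -addnn exprD.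
rewrite sqr_frobenius_norm_cV trmx_mul (trmxX _ AT) -[A ^+ _]/B -[x^T *m B *m _]mulmxA (mulmxA B).
apply: (le_trans (dot_le_frobenius _ _)).
by rewrite ler_piMl ?frobenius_norm_ge0.
Qed.

(** With B half of the power, the trace is the squared Frobenius norm of B, which dominates
    |Bx|^2. *)
Lemma frobenius_norm_le_trace n (A : 'M[R]_n) (x : 'cV[R]_n) a :
  A^T = A -> frobenius_norm x <= 1 ->
  frobenius_norm (A *m x) ^+ (2 ^ a.+1) <= \tr (A ^+ (2 ^ a.+1)).
Proof.
move=> AT x1; set B := A ^+ (2 ^ a).
have -> : A ^+ (2 ^ a.+1) = B *m B^T.
  by rewrite trmxX // expnS mul2n -addnn exprD.
rewrite -sqr_frobenius_norm_tr expnS mulnC exprM.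
rewrite lerXn2r ?nnegrE ?exprn_ge0 ?frobenius_norm_ge0 //.
apply: (le_trans (frobenius_norm_sym_expr _ AT x1)).
by apply: (le_trans (frobenius_normM _ _)); rewrite ler_piMr ?frobenius_norm_ge0.
Qed.

Lemma operator_norm_le m n (A : 'M[R]_(m, n)) (c : R) :
  (forall x : 'cV_n, frobenius_norm x <= 1 -> frobenius_norm (A *m x) <= c) ->
  operator_norm A <= c.
Proof.
move=> Ac; apply: ge_sup; last by move=> _ [x x1 <-]; exact: Ac.
have f0 : frobenius_norm (0 : 'cV[R]_n) <= 1 by rewrite frobenius_norm0.
by exists (frobenius_norm (A *m (0 : 'cV[R]_n))); exists 0.
Qed.

Lemma frobenius_norm_bound_cV m n (A : 'M[R]_(m, n)) (c : R) (x : 'cV[R]_n) :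
  (forall x : 'cV_n, frobenius_norm x <= 1 -> frobenius_norm (A *m x) <= c) ->
  frobenius_norm (A *m x) <= c * frobenius_norm x.
Proof.
move=> Ac; have [x0|x0] := eqVneq (frobenius_norm x) 0.
  by rewrite (frobenius_norm_eq0 x0) mulmx0 !frobenius_norm0 mulr0.
have xp : 0 < frobenius_norm x by rewrite lt_def x0 frobenius_norm_ge0.
have := Ac ((frobenius_norm x)^-1 *: x).
rewrite -scalemxAr !frobenius_normZ gtr0_norm ?invr_gt0 // mulVf // => /(_ (lexx _)).
by rewrite ler_pdivrMl // mulrC.
Qed.

Lemma frobenius_norm_bound m n p (A : 'M[R]_(m, n)) (c : R) (B : 'M[R]_(n, p)) :
  0 <= c ->
  (forall x : 'cV_n, frobenius_norm x <= 1 -> frobenius_norm (A *m x) <= c) ->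
  frobenius_norm (A *m B) <= c * frobenius_norm B.
Proof.
move=> c0 Ac; rewrite frobenius_norm_le // !sqr_frobenius_norm.
rewrite exchange_big [X in _ <= _ * X]exchange_big mulr_sumr /=; apply: ler_sum => j _.
have := frobenius_norm_bound_cV (col j B) Ac.
rewrite frobenius_norm_le // !sqr_frobenius_norm.
rewrite [X in X <= _](eq_bigr (fun i => (A *m B) i j ^+ 2)); last first.
  by move=> i _; rewrite big_ord1 !mxE; congr (_ ^+ 2); apply: eq_bigr => k _; rewrite mxE.
rewrite [X in _ * X](eq_bigr (fun i => B i j ^+ 2)) // => i _.
by rewrite big_ord1 mxE.
Qed.

(** Each diagonal entry is <e_i, A^l e_i>, hence at most the l-th power of a bound for the operator
    norm. *)
Lemma trace_expr_bound n (A : 'M[R]_n) (s : R) l : 0 <= s ->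
  (forall u v : 'cV_n, frobenius_norm u <= 1 -> frobenius_norm v <= 1 ->
     (u^T *m A *m v) 0 0 <= s) ->
  \tr (A ^+ l) <= n%:R * s ^+ l.
Proof.
move=> s0 As.
(* Testing with u = Av / |Av| turns the one-sided bilinear bound into a bound for |Av|. *)
have Av (v : 'cV_n) : frobenius_norm v <= 1 -> frobenius_norm (A *m v) <= s.
  move=> v1; set w := A *m v; have [w0|w0] := eqVneq (frobenius_norm w) 0; first by rewrite w0.
  have wp : 0 < frobenius_norm w by rewrite lt_def w0 frobenius_norm_ge0.
  have := As ((frobenius_norm w)^-1 *: w) v.
  rewrite frobenius_normZ gtr0_norm ?invr_gt0 // mulVf // => /(_ (lexx _) v1).
  rewrite linearZ /= -!scalemxAl mxE -mulmxA -/w -sqr_frobenius_norm_cV.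
  by rewrite expr2 mulKf.
have Al (v : 'cV_n) k : frobenius_norm (A ^+ k *m v) <= s ^+ k * frobenius_norm v.
  elim: k => [|k IH]; first by rewrite !expr0 mul1mx mul1r.
  rewrite exprS -[A * _]/(A *m _) -mulmxA.
  apply: (le_trans (frobenius_norm_bound_cV _ Av)).
  by rewrite exprS -mulrA ler_wpM2l.
rewrite /mxtrace -[X in _ <= X%:R * _]card_ord mulr_natl -sumr_const.
apply: ler_sum => i _; pose e : 'cV[R]_n := delta_mx i 0.
have e1 : frobenius_norm e = 1.
  apply/eqP; rewrite -(@eqrXn2 _ 2) ?frobenius_norm_ge0 // expr1n sqr_frobenius_norm.
  rewrite (bigD1 i) //= big_ord1 mxE !eqxx /= expr1n big1 ?addr0 // => j ji.
  by rewrite big_ord1 mxE (negbTE ji) expr0n.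
have -> : (A ^+ l) i i = (e^T *m (A ^+ l *m e)) 0 0.
  by rewrite mulmxA trmx_delta -rowE -colE !mxE.
by apply: (le_trans (dot_le_frobenius _ _)); rewrite e1 mul1r -[leRHS]mulr1 -e1 Al.
Qed.

(** [Q] competes in the minimization, so [Pi X] is no further from [X] than [Q] is; the triangle
    inequality does the rest. *)
Lemma frobenius_norm_projection d (G : set 'M[R]_d) Pi X Q :
  is_projection G Pi -> G Q ->
  frobenius_norm (Pi X - Q) <= 2 * frobenius_norm (X - Q).
Proof.
move=> hPi GQ; have [_ /(_ _ GQ) h] := hPi X.
have -> : Pi X - Q = - (X - Pi X) + (X - Q) by rewrite opprB addrA subrK.
apply: (le_trans (frobenius_normD _ _)).
by rewrite frobenius_normN mulrDl mul1r lerD2r.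
Qed.

End MatrixNorms.

(** * A skewed sub-Gaussian law on a finite space *)

Section Elementary.
Context {R : realType}.

(** The inequality 1 + y <= exp y at y = x and y = -x replaces Taylor's formula: it gives x <= exp x
    - 1 <= x exp x, and one of the two sides is used once more after multiplication by x, according
    to its sign. *)
Lemma expR_le1DxDsqr (x : R) : expR x <= 1 + x + x ^+ 2 * expR `|x|.
Proof.
have e1 : expR x - 1 <= x * expR x.
  have := expR_ge1Dx (- x); rewrite expRN => h.
  have ep := expR_gt0 x.
  have : (1 - x) * expR x <= 1 by rewrite -ler_pdivlMr // mul1r.
  lra.
have e2 := expR_ge1Dx x.
have [x0|x0] := leP 0 x.
  rewrite ger0_norm //; have := expR_gt0 x => ep.
  have : x * (expR x - 1) <= x * (x * expR x) by apply: ler_wpM2l.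
  rewrite expr2; lra.
rewrite ltr0_norm //.
have e3 : 1 <= expR (- x) by rewrite -expR0 ler_expR; lra.
have e4 : x ^+ 2 <= x ^+ 2 * expR (- x) by rewrite ler_peMr ?sqr_ge0.
have e5 : x * (expR x - 1) <= x * x by apply: ler_wnM2l; lra.
rewrite expr2 in e4 *; lra.
Qed.

Lemma expR_half_le2 : expR (2^-1 : R) <= 2.
Proof.
have := expR_ge1Dx (- (2^-1 : R)); rewrite expRN => h.
have ep := expR_gt0 (2^-1 : R).
have : 2^-1 <= (expR (2^-1 : R))^-1 by lra.
by rewrite lef_pV2 ?posrE.
Qed.

Lemma geometric_sum_le2 (n : nat) : \sum_(j < n) (2^-1 : R) ^+ j <= 2.
Proof.
have -> : \sum_(j < n) (2^-1 : R) ^+ j = 2 - 2 * 2^-1 ^+ n.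
  elim: n => [|n IH]; first by rewrite big_ord0 expr0; lra.
  by rewrite big_ord_recr /= IH exprS; lra.
by rewrite gerBl mulr_ge0 // exprn_ge0.
Qed.

(** Raise y <= exp y to the power k at y = c |x| / k, then bound exp (c |x|) by the sum over both
    signs. *)
Lemma normrX_le_expR (k : nat) (c x : R) : 0 < c ->
  `|x| ^+ k <= (k%:R / c) ^+ k * (expR (c * x) + expR (- (c * x))).
Proof.
move=> c0; case: k => [|k].
  rewrite !expr0 mul1r; have := expR_ge1Dx (c * x); have := expR_ge1Dx (- (c * x)).
  lra.
set m := k.+1; have m0 : (0 : R) < m%:R by rewrite ltr0n.
have h : c * `|x| / m%:R <= expR (c * `|x| / m%:R).
  by rewrite (le_trans _ (expR_ge1Dx _)) // lerDr.
have : `|x| ^+ m <= (m%:R / c) ^+ m * expR (c * `|x|).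
  have -> : c * `|x| = m%:R * (c * `|x| / m%:R) by field; rewrite gt_eqF.
  rewrite expRM_natl -exprMn lerXn2r ?nnegrE ?mulr_ge0 ?expR_ge0 ?invr_ge0 ?(ltW c0) //.
  apply: (@le_trans _ _ (m%:R / c * (c * `|x| / m%:R))).
    by rewrite le_eqVlt; apply/orP; left; apply/eqP; field; rewrite !gt_eqF.
  by rewrite ler_wpM2l // divr_ge0 // ltW.
move=> /le_trans; apply; apply: ler_wpM2l.
  by rewrite exprn_ge0 // divr_ge0 // ltW.
have [x0|x0] := leP 0 x; first by rewrite ger0_norm // lerDl expR_ge0.
by rewrite ltr0_norm // mulrN lerDr expR_ge0.
Qed.

(* moment_root k ^+ k bounds, up to scaling, the absolute value of a centered
   sub-Gaussian moment of order k; the value at 1 records the zero mean. *)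
Definition moment_root (k : nat) : R := if k == 1%N then 0 else Num.sqrt k%:R.

Lemma moment_root_ge0 k : 0 <= moment_root k.
Proof. by rewrite /moment_root; case: ifP => // _; exact: sqrtr_ge0. Qed.

Lemma prod_count (E K : finType) (g : K -> R) (f : E -> K) (s : seq E) :
  \prod_(e <- s) g (f e) = \prod_k g k ^+ count (fun e => f e == k) s.
Proof.
elim: s => [|e s IH]; first by rewrite big_nil big1.
rewrite big_cons IH /=.
under [RHS]eq_bigr do rewrite exprD.
rewrite big_split /=; congr (_ * _).
rewrite (bigD1 (f e)) //= eqxx expr1 big1 ?mulr1 // => k.
by rewrite eq_sym => /negbTE->.
Qed.
End Elementary.

Section ComparisonLaw.
Context {R : realType}.
Variable l : nat.

Let Om : finType := ('I_3 * 'I_l.+1)%type.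
Let Z : R := \sum_(j < l.+1) (4^-1) ^+ j.
(** A sign variable uniform on three points, times a level j with geometric weight 4^-j. Level j
    carries values of size 4 sqrt j up to the skew, so the moment of order k is already large enough
    on level k alone. Levels stop at [l] because no edge of a walk of length [l] has higher
    multiplicity. *)
Definition law_prob (o : Om) : R := 3^-1 * (4^-1) ^+ o.2 / Z.
Let skew (i : 'I_3) : R := if i == 0 then 2 else -1.
(* The sign is skewed so that the odd moments of order at least 3 are positive
   although the mean is 0: a walk may use an edge an odd number of times. *)
Definition law_val (o : Om) : R := 4 * skew o.1 * Num.sqrt (o.2)%:R.

Let Z_ge1 : 1 <= Z.
Proof.
rewrite /Z big_ord_recl expr0 lerDl; apply: sumr_ge0 => i _.
by rewrite exprn_ge0.
Qed.

Let Z_le2 : Z <= 2.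
Proof.
apply: le_trans (geometric_sum_le2 l.+1); apply: ler_sum => j _.
by rewrite lerXn2r ?nnegrE //; lra.
Qed.

Lemma law_prob_ge0 o : 0 <= law_prob o.
Proof.
by rewrite /law_prob divr_ge0 ?mulr_ge0 ?exprn_ge0 //; have := Z_ge1; lra.
Qed.

Let law_sum (F : 'I_3 -> 'I_l.+1 -> R) :
  \sum_o law_prob o * F o.1 o.2 =
  \sum_(j < l.+1) (4^-1) ^+ j / Z * ((F 0 j + F 1 j + F 2 j) / 3).
Proof.
rewrite -(pair_bigA _ (fun i j => law_prob (i, j) * F i j)) /= exchange_big /=.
apply: eq_bigr => j _; rewrite !big_ord_recl big_ord0 /law_prob /=.
have -> : lift ord0 ord0 = 1 :> 'I_3 by apply/val_inj.
have -> : lift ord0 (lift ord0 ord0) = 2 :> 'I_3 by apply/val_inj.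
by field; rewrite gt_eqF //; have := Z_ge1; lra.
Qed.

Lemma law_prob_sum1 : \sum_o law_prob o = 1.
Proof.
transitivity (\sum_o law_prob o * 1); first by apply: eq_bigr => o; rewrite mulr1.
rewrite (law_sum (fun _ _ => 1)).
rewrite (eq_bigr (fun j : 'I_l.+1 => (4^-1) ^+ j / Z)); last by move=> j _; field; rewrite gt_eqF //; have := Z_ge1; lra.
by rewrite -mulr_suml -/Z divff // gt_eqF //; have := Z_ge1; lra.
Qed.

(** For k >= 2 only the level j = k is kept: its weight 4^-k cancels the factor 4^k of the values,
    and the k-th moment of the skew, at least 2, pays for the normalization [Z <= 2]. Order 0 is the
    total mass, and order 1 vanishes on both sides. *)
Lemma law_moment k : (k <= l)%N ->
  moment_root k ^+ k <= \sum_o law_prob o * law_val o ^+ k.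
Proof.
move=> kl; have Z0 : 0 < Z by have := Z_ge1; lra.
rewrite (law_sum (fun i j => (4 * skew i * Num.sqrt j%:R) ^+ k)) /skew /=.
set m : R := (2 ^+ k + 2 * (-1) ^+ k) / 3.
have E (j : 'I_l.+1) : ((4 * 2 * Num.sqrt j%:R) ^+ k + (4 * -1 * Num.sqrt j%:R) ^+ k +
    (4 * -1 * Num.sqrt j%:R) ^+ k) / 3 = m * (4 ^+ k * Num.sqrt j%:R ^+ k) :> R.
  by rewrite !exprMn /m; field.
under eq_bigr do rewrite E.
have [k0|kn0] := posnP k.
  rewrite k0 !expr0 /m k0 !expr0 (_ : (1 + 2 * 1) / 3 = 1 :> R); last by field.
  under eq_bigr do rewrite !mul1r mulr1.
  by rewrite -mulr_suml divff // gt_eqF.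
have [k1|kn1] := eqVneq k 1%N.
  rewrite /moment_root k1 eqxx expr1 /m k1 !expr1.
  rewrite (_ : (2 + 2 * -1) / 3 = 0 :> R); last by field.
  by rewrite big1 // => j _; rewrite mul0r mulr0.
(* Equality holds for k = 2, where m = (4 + 2) / 3, and for k = 3, where m = (8 - 2) / 3. *)
have m2 : 2 <= m.
  rewrite /m; have -> : (-1) ^+ k = (-1) ^+ (odd k) :> R by rewrite signr_odd.
  have [k2|k3] : k = 2%N \/ (3 <= k)%N by lia.
    by rewrite k2 /= expr0; lra.
  have : (8 : R) <= 2 ^+ k.
    rewrite (_ : 8 = 2 ^+ 3); last by ring.
    by rewrite ler_eXn2l //; lra.
  by case: (odd k); rewrite ?expr1 ?expr0; lra.
have kl1 : (k < l.+1)%N by [].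
rewrite (bigD1 (Ordinal kl1)) //= /moment_root (negbTE kn1).
apply: ler_wpDr.
  apply: sumr_ge0 => j _; apply: mulr_ge0; first by rewrite divr_ge0 ?exprn_ge0 ?(ltW Z0).
  by apply: mulr_ge0; [lra | rewrite mulr_ge0 ?exprn_ge0 ?sqrtr_ge0].
rewrite exprVn; set q := Num.sqrt _ ^+ k.
have q0 : 0 <= q by rewrite exprn_ge0 ?sqrtr_ge0.
have p4 : (0 : R) < 4 ^+ k by rewrite exprn_gt0.
have -> : (4 ^+ k)^-1 / Z * (m * (4 ^+ k * q)) = m / Z * q.
  by field; rewrite !gt_eqF.
rewrite ler_peMl // ler_pdivlMr // mul1r.
by have := Z_le2; lra.
Qed.

Lemma law_mean : (0 < l)%N -> \sum_o law_prob o * law_val o = 0.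
Proof.
move=> l0; rewrite (law_sum (fun i j => 4 * skew i * Num.sqrt j%:R)) /skew /=.
by rewrite big1 // => j _; rewrite [X in _ * X](_ : _ = 0) ?mulr0 //; field.
Qed.

(** Values of order sqrt j with probability of order 4^-j have a Gaussian tail. Since the mean is 0,
    the second-order bound on the exponential leaves only a term in x^2. *)
Lemma law_mgf (x : R) : (0 < l)%N ->
  \sum_o law_prob o * expR (x * law_val o) <= expR (576 * x ^+ 2).
Proof.
move=> l0; have Z0 : 0 < Z by have := Z_ge1; lra.
have step : \sum_o law_prob o * expR (x * law_val o) <=
    1 + x ^+ 2 * \sum_o law_prob o * (law_val o ^+ 2 * expR `|x * law_val o|).
  apply: (@le_trans _ _ (\sum_o (law_prob o + x * (law_prob o * law_val o) +
      x ^+ 2 * (law_prob o * (law_val o ^+ 2 * expR `|x * law_val o|))))).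
    apply: ler_sum => o _; have := law_prob_ge0 o; have := expR_le1DxDsqr (x * law_val o).
    move=> h /ler_wpM2l/(_ _ _ h)/le_trans; apply.
    by rewrite le_eqVlt; apply/orP; left; apply/eqP; ring.
  rewrite !big_split /= law_prob_sum1 -!mulr_sumr law_mean //.
  by rewrite mulr0 addr0.
apply: (le_trans step).
(* Growth at most 2^j in the level: against the weight 4^-j it leaves a geometric series of ratio
   1/2. *)
have bound (o : Om) : law_val o ^+ 2 * expR `|x * law_val o| <=
    256 * expR (64 * x ^+ 2) * 2 ^+ o.2.
  set j := (o.2 : nat).
  have sk : `|skew o.1| <= 2 by rewrite /skew; case: ifP => _; rewrite ?normrN ?normr1 ?ger0_norm //; lra.
  set q := Num.sqrt (j%:R : R).
  have q0 : 0 <= q by exact: sqrtr_ge0.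
  have qq : q ^+ 2 = j%:R by rewrite sqr_sqrtr.
  have vn : `|law_val o| <= 8 * q.
    rewrite /law_val !normrM (ger0_norm q0) (ger0_norm (_ : (0:R) <= 4)) //.
    by rewrite ler_wpM2r //; lra.
  have v2 : law_val o ^+ 2 <= 64 * j%:R.
    rewrite -real_normK ?num_real // -qq.
    have -> : 64 * q ^+ 2 = (8 * q) ^+ 2 by ring.
    by rewrite lerXn2r ?nnegrE ?mulr_ge0.
  (* From (8 |x| - q / 2)^2 >= 0. The share j / 4 is chosen so that, with a second exp (j / 4) spent
     on the factor j, the total is exp (j / 2) <= 2^j. *)
  have xv : `|x * law_val o| <= 64 * x ^+ 2 + j%:R / 4.
    rewrite normrM (@le_trans _ _ (`|x| * (8 * q))) ?ler_wpM2l //.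
    rewrite -qq -(real_normK (num_real x)).
    by have := sqr_ge0 (8 * `|x| - q / 2); lra.
  have je : (j%:R : R) <= 4 * expR (j%:R / 4).
    by have := expR_ge1Dx ((j%:R : R) / 4); have : (0 : R) <= j%:R by []; lra.
  have e2 : expR ((j%:R : R) / 4) * expR (j%:R / 4) <= 2 ^+ j.
    rewrite -expRD (_ : _ + _ = j%:R * 2^-1); last by field.
    by rewrite expRM_natl lerXn2r ?nnegrE ?expR_ge0 // expR_half_le2.
  have a0 := expR_ge0 ((j%:R : R) / 4); have b0 := expR_ge0 (64 * x ^+ 2).
  apply: (@le_trans _ _ (64 * j%:R * (expR (64 * x ^+ 2) * expR (j%:R / 4)))).
    by apply: ler_pM; rewrite ?sqr_ge0 ?expR_ge0 // -expRD ler_expR.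
  have -> : 64 * j%:R * (expR (64 * x ^+ 2) * expR (j%:R / 4)) =
    64 * expR (64 * x ^+ 2) * (j%:R * expR (j%:R / 4)) :> R by ring.
  have -> : 256 * expR (64 * x ^+ 2) * 2 ^+ j = 64 * expR (64 * x ^+ 2) * (4 * 2 ^+ j) :> R by ring.
  rewrite ler_wpM2l ?mulr_ge0 //.
  apply: (@le_trans _ _ (4 * expR (j%:R / 4) * expR (j%:R / 4))); first by rewrite ler_wpM2r.
  by rewrite -mulrA ler_wpM2l.
have K0 : 0 <= 256 * expR (64 * x ^+ 2) by apply: mulr_ge0; [exact: ler0n|exact: expR_ge0].
have S : \sum_o law_prob o * (law_val o ^+ 2 * expR `|x * law_val o|) <=
    512 * expR (64 * x ^+ 2).
  apply: (@le_trans _ _ (\sum_o law_prob o * (256 * expR (64 * x ^+ 2) * 2 ^+ o.2))).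
    by apply: ler_sum => o _; rewrite ler_wpM2l ?law_prob_ge0.
  rewrite (law_sum (fun _ j => 256 * expR (64 * x ^+ 2) * 2 ^+ j)).
  apply: (@le_trans _ _ (\sum_(j < l.+1) 256 * expR (64 * x ^+ 2) * (2^-1) ^+ j)).
    apply: ler_sum => j _.
    have -> : (4^-1 : R) ^+ j / Z * ((256 * expR (64 * x ^+ 2) * 2 ^+ j +
       256 * expR (64 * x ^+ 2) * 2 ^+ j + 256 * expR (64 * x ^+ 2) * 2 ^+ j) / 3) =
       (256 * expR (64 * x ^+ 2) * (4^-1 * 2) ^+ j) * Z^-1.
      by rewrite exprMn; field; rewrite gt_eqF.
    rewrite (_ : 4^-1 * 2 = 2^-1 :> R); last by field.
    apply: ler_piMr; last by rewrite invf_le1.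
    by apply: mulr_ge0; [exact: K0|apply: exprn_ge0; rewrite invr_ge0 ler0n].
  rewrite -mulr_sumr.
  have -> : 512 * expR (64 * x ^+ 2) = 256 * expR (64 * x ^+ 2) * 2 by ring.
  exact: ler_wpM2l K0 _ _ (geometric_sum_le2 _).
(* The 512 comes from 1 + 512 x^2 <= exp (512 x^2), the 64 from the exponential carried along. *)
have -> : 576 * x ^+ 2 = 512 * x ^+ 2 + 64 * x ^+ 2 by ring.
have h1 := expR_ge1Dx (512 * x ^+ 2).
have h2 : 1 <= expR (64 * x ^+ 2) by rewrite -expR0 ler_expR mulr_ge0 ?sqr_ge0.
have h3 : x ^+ 2 * \sum_o law_prob o * (law_val o ^+ 2 * expR `|x * law_val o|) <=
  x ^+ 2 * (512 * expR (64 * x ^+ 2)) by rewrite ler_wpM2l ?sqr_ge0.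
rewrite expRD (@le_trans _ _ ((1 + 512 * x ^+ 2) * expR (64 * x ^+ 2))) //.
  lra.
by rewrite ler_wpM2r ?expR_ge0.
Qed.

End ComparisonLaw.

(** * Finite product spaces and nets *)

Section FiniteProduct.
Context {R : realType} {E Om : finType}.
Variables (pr : Om -> R).
Hypothesis pr_ge0 : forall o, 0 <= pr o.

(** Expectation when the coordinates [phi e] are independent with law [pr]; as a finite sum it
    raises no question of integrability. *)
Definition prod_mean (F : {ffun E -> Om} -> R) : R :=
  \sum_(phi : {ffun E -> Om}) (\prod_e pr (phi e)) * F phi.

(** Independence of the coordinates is distributivity of the product over the sum. *)
Lemma prod_mean_prod (g : E -> Om -> R) :
  prod_mean (fun phi => \prod_e g e (phi e)) = \prod_e \sum_o pr o * g e o.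
Proof.
rewrite bigA_distr_bigA; apply: eq_bigr => phi _.
by rewrite -big_split.
Qed.

Lemma prod_mean_le F G : (forall phi, F phi <= G phi) -> prod_mean F <= prod_mean G.
Proof.
by move=> FG; apply: ler_sum => phi _; rewrite ler_wpM2l ?prodr_ge0.
Qed.

Lemma prod_meanZ c F : prod_mean (fun phi => c * F phi) = c * prod_mean F.
Proof. by rewrite mulr_sumr; apply: eq_bigr => phi _; rewrite mulrCA. Qed.

Lemma prod_meanD F G :
  prod_mean (fun phi => F phi + G phi) = prod_mean F + prod_mean G.
Proof. by rewrite -big_split; apply: eq_bigr => phi _; rewrite mulrDr. Qed.

Lemma prod_mean_sum (I : finType) (P : pred I) (F : I -> {ffun E -> Om} -> R) :
  prod_mean (fun phi => \sum_(i | P i) F i phi) = \sum_(i | P i) prod_mean (F i).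
Proof.
rewrite exchange_big; apply: eq_bigr => phi _.
by rewrite mulr_sumr.
Qed.

Lemma prod_mean_walk_sum (V : finType) j (F : seq V -> {ffun E -> Om} -> R) s :
  prod_mean (fun phi => walk_sum j (F ^~ phi) s) = walk_sum j (fun s => prod_mean (F s)) s.
Proof.
elim: j s => [|j IH] s //=.
by rewrite prod_mean_sum; apply: eq_bigr => y _; rewrite IH.
Qed.

Lemma prod_mean_linear_mgf (y : Om -> R) (C : R) (c : E -> R) :
  (forall x, \sum_o pr o * expR (x * y o) <= expR (C * x ^+ 2)) ->
  prod_mean (fun phi => expR (\sum_e c e * y (phi e))) <=
    expR (C * \sum_e c e ^+ 2).
Proof.
move=> mgf.
have -> : prod_mean (fun phi => expR (\sum_e c e * y (phi e))) =
    prod_mean (fun phi => \prod_e expR (c e * y (phi e))).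
  by apply: eq_bigr => phi _; rewrite expR_sum.
rewrite (prod_mean_prod (fun e o => expR (c e * y o))).
rewrite mulr_sumr expR_sum; apply: ler_prod => e _; rewrite mgf andbT.
by apply: sumr_ge0 => o _; rewrite mulr_ge0 ?expR_ge0.
Qed.

(** The exponential bound on a power is used at the parameters sqrt l and - sqrt l, where the moment
    generating function is itself an l-th power, [expR (C * B) ^+ l]. *)
Lemma prod_mean_linear_moment (y : Om -> R) (C B : R) (c : E -> R) (l : nat) :
  (0 < l)%N -> ~~ odd l -> 0 <= C ->
  (forall x, \sum_o pr o * expR (x * y o) <= expR (C * x ^+ 2)) ->
  \sum_e c e ^+ 2 <= B ->
  prod_mean (fun phi => (\sum_e c e * y (phi e)) ^+ l) <=
    2 * Num.sqrt l%:R ^+ l * expR (C * B) ^+ l.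
Proof.
move=> l0 evl C0 mgf cB; set q : R := Num.sqrt l%:R.
have q0 : 0 < q by rewrite sqrtr_gt0 ltr0n.
have qq : q ^+ 2 = l%:R by rewrite sqr_sqrtr.
have mgf' (x : R) : x ^+ 2 = l%:R ->
    prod_mean (fun phi => expR (x * \sum_e c e * y (phi e))) <= expR (C * B) ^+ l.
  move=> xl.
  have -> : prod_mean (fun phi => expR (x * \sum_e c e * y (phi e))) =
      prod_mean (fun phi => expR (\sum_e (x * c e) * y (phi e))).
    apply: eq_bigr => phi _; congr (_ * expR _); rewrite mulr_sumr.
    by apply: eq_bigr => e _; rewrite mulrA.
  apply: (le_trans (prod_mean_linear_mgf _ mgf)).
  under eq_bigr do rewrite exprMn.
  rewrite -mulr_sumr xl -expRM_natl ler_expR mulrCA ler_wpM2l //.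
  by rewrite ler_wpM2l.
apply: (@le_trans _ _ (prod_mean (fun phi => (l%:R / q) ^+ l *
    (expR (q * \sum_e c e * y (phi e)) + expR (- q * \sum_e c e * y (phi e)))))).
  apply: prod_mean_le => phi; rewrite mulNr.
  have := normrX_le_expR l (\sum_e c e * y (phi e)) q0.
  by rewrite -normrX ger0_norm // exprn_even_ge0.
rewrite prod_meanZ prod_meanD -qq expr2 mulfK ?gt_eqF //.
have hq := mgf' q qq; have hNq := mgf' (- q) ltac:(by rewrite sqrrN).
rewrite [2 * _]mulrC -[leRHS]mulrA ler_wpM2l ?exprn_ge0 ?(ltW q0) //.
by rewrite mulrDl mul1r lerD.
Qed.
End FiniteProduct.

Section Net.
Context {R : realType}.
Variable r : nat.
Hypothesis r_gt0 : (0 < r)%N.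

(** Codes for the grid of mesh 1 / sqrt r: a sign and a magnitude per coordinate. The magnitude
    bound 4r is implied by membership in the net, where the squares sum to at most 4r, i.e. the
    point has norm at most 2. Zero has two codes, which is harmless for an upper bound on the
    count. *)
Definition net_index : finType := {ffun 'I_r -> bool * 'I_(4 * r).+1}.
Definition net_int (c : net_index) (a : 'I_r) : R := (-1) ^+ (c a).1 * (c a).2%:R.
Definition in_net (c : net_index) : bool := (\sum_a (c a).2 ^ 2 <= 4 * r)%N.
Definition net_point (c : net_index) : 'cV[R]_r :=
  \col_a (net_int c a / Num.sqrt r%:R).

Let q : R := Num.sqrt r%:R.
Let q_gt0 : 0 < q. Proof. by rewrite sqrtr_gt0 ltr0n. Qed.
Let qq : q ^+ 2 = r%:R. Proof. by rewrite sqr_sqrtr. Qed.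

Lemma net_point_norm c : in_net c -> \sum_a net_point c a 0 ^+ 2 <= 4.
Proof.
move=> cN; have -> : \sum_a net_point c a 0 ^+ 2 = (\sum_a (c a).2 ^ 2)%:R / r%:R.
  rewrite natr_sum mulr_suml; apply: eq_bigr => a _.
  by rewrite mxE exprMn exprVn qq exprMn -exprM mulnC exprM sqrrN !expr1n mul1r natrX.
by rewrite ler_pdivrMr ?ltr0n // -natrM ler_nat.
Qed.

(** Exponential weighting: on the net the magnitudes sum to at most 4r, so the product of the
    factors 16 * 2^-m is at least 1 there. Summed over all codes it factorizes, each coordinate
    giving at most 16 * 2 * 2 = 64 (sign, then geometric series). *)
Lemma card_net : #|in_net|%:R <= (64 : R) ^+ r.
Proof.
have -> : #|in_net|%:R = \sum_(c | in_net c) (1 : R) by rewrite sumr_const.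
apply: (@le_trans _ _ (\sum_(c | in_net c) \prod_(a < r) (16 * (2^-1 : R) ^+ (c a).2))).
  apply: ler_sum => c cN; rewrite big_split /= prodr_const card_ord prodrXr.
  rewrite (_ : (16 : R) = 2 ^+ 4); last by ring.
  rewrite -exprM exprVn ler_pdivlMr ?exprn_gt0 // mul1r ler_eXn2l ?ltr1n //.
  apply: leq_trans cN; apply: leq_sum => a _.
  by rewrite -mulnn; case: (nat_of_ord _) => // k; rewrite leq_pmull.
apply: (@le_trans _ _ (\sum_(c : net_index) \prod_(a < r) (16 * (2^-1 : R) ^+ (c a).2))).
  rewrite [leRHS](bigID in_net) /= lerDl; apply: sumr_ge0 => c _.
  by apply: prodr_ge0 => a _; rewrite mulr_ge0 ?exprn_ge0.
rewrite -(bigA_distr_bigA (fun (a : 'I_r) (o : bool * 'I_(4 * r).+1) => 16 * (2^-1 : R) ^+ o.2)).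
rewrite prodr_const card_ord lerXn2r ?nnegrE //.
  by apply: sumr_ge0 => o _; rewrite mulr_ge0 ?exprn_ge0.
rewrite -(pair_bigA _ (fun (b : bool) (j : 'I_(4 * r).+1) => 16 * (2^-1 : R) ^+ j)) /=.
rewrite big_bool /= -mulr_sumr; have := @geometric_sum_le2 R (4 * r).+1.
by lra.
Qed.

(** Round to 0 when w z <= 0 and away from 0 otherwise: w z can only grow, and the magnitude is at
    most |z| + 1, whose square is at most 2 z^2 + 2. *)
Lemma round_coordinate (w z : R) : z ^+ 2 <= r%:R -> exists o : bool * 'I_(4 * r).+1,
  w * z <= w * ((-1) ^+ o.1 * o.2%:R) /\ (o.2%:R : R) ^+ 2 <= 2 * z ^+ 2 + 2.
Proof.
move=> zr; have [wz|wz] := leP (w * z) 0.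
  exists (false, ord0) => /=; rewrite mulr0 mulr0; split => //.
  by rewrite expr0n /=; have := sqr_ge0 z; lra.
set k := (Num.truncn `|z|).+1.
have [k1 k2] : (k%:R : R) <= `|z| + 1 /\ `|z| <= k%:R.
  have /andP[h1 h2] := truncn_itv (normr_ge0 z).
  by rewrite /k -natr1 lerD2r h1 natr1 ltW.
have k3 : (k%:R : R) ^+ 2 <= 2 * z ^+ 2 + 2.
  rewrite -(real_normK (num_real z)).
  have : k%:R ^+ 2 <= (`|z| + 1) ^+ 2 by rewrite lerXn2r ?nnegrE ?addr_ge0.
  by have := sqr_ge0 (`|z| - 1); lra.
have k4 : (k < (4 * r).+1)%N.
  rewrite ltnS; apply: (@leq_trans (k ^ 2)); first by rewrite -mulnn leq_pmull.
  rewrite -(@ler_nat R) natrX natrM; have : (1 : R) <= r%:R by rewrite ler1n.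
  lra.
exists (z < 0, Ordinal k4); split => //=.
have [z0|z0] := ltP z 0.
  move: wz k2; rewrite (ltr0_norm z0) => wz k2; rewrite expr1 mulN1r.
  have w0 : w < 0 by rewrite -(nmulr_lgt0 _ z0).
  by rewrite ler_wnM2l ?(ltW w0) // lerNl.
move: k2; rewrite (ger0_norm z0) => k2; rewrite expr0 mul1r.
have zp : 0 < z by rewrite lt_def z0 andbT; apply: contraTneq wz => ->; rewrite mulr0 ltxx.
have w0 : 0 < w by rewrite -(pmulr_lgt0 _ zp).
by rewrite ler_wpM2l // ltW.
Qed.

(* A linear form on a grid cell is maximal at a corner. *)
Lemma net_rounding (w : 'I_r -> R) (u : 'cV[R]_r) : frobenius_norm u <= 1 ->
  exists2 c, in_net c & \sum_a w a * u a 0 <= \sum_a w a * net_point c a 0.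
Proof.
move=> u1.
have u2 : \sum_a u a 0 ^+ 2 <= 1.
  have -> : \sum_a u a 0 ^+ 2 = frobenius_norm u ^+ 2.
    by rewrite sqr_frobenius_norm; apply: eq_bigr => a _; rewrite big_ord1.
  by rewrite expr_le1 // frobenius_norm_ge0.
have zr a : (q * u a 0) ^+ 2 <= r%:R.
  rewrite exprMn qq ler_piMr // (le_trans _ u2) // (bigD1 a) //= lerDl.
  by apply: sumr_ge0 => b _; exact: sqr_ge0.
pose P a (o : bool * 'I_(4 * r).+1) := w a * (q * u a 0) <= w a * ((-1) ^+ o.1 * o.2%:R) /\
   (o.2%:R : R) ^+ 2 <= 2 * (q * u a 0) ^+ 2 + 2.
have /(@fin_all_exists _ _ P)[f fP] a : exists o, P a o by exact: round_coordinate.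
exists [ffun a => f a].
  rewrite /in_net -(@ler_nat R) natr_sum.
  (* Since |u| <= 1 this sums to at most 2r + 2r, which is where the bound 4r defining the net comes
     from. *)
  apply: (@le_trans _ _ (\sum_(a < r) (2 * (q * u a 0) ^+ 2 + 2))).
    by apply: ler_sum => a _; rewrite ffunE natrX; have [] := fP a.
  rewrite big_split /= sumr_const card_ord -mulr_sumr.
  under eq_bigr do rewrite exprMn qq.
  rewrite -mulr_sumr natrM -mulr_natr.
  have : r%:R * \sum_i u i 0 ^+ 2 <= (r%:R : R) * 1 by rewrite ler_wpM2l.
  lra.
apply: ler_sum => a _; rewrite mxE /net_int ffunE mulrA ler_pdivlMr ?q_gt0 //.
by have [h _] := fP a; rewrite -mulrA (mulrC _ q).
Qed.

(** The two arguments are rounded in turn, the form being linear in each. Rounding increases the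
    form outright, so there is no approximation error to absorb. *)
Lemma bilinear_le_net (A : 'M[R]_r) (u v : 'cV[R]_r) :
  frobenius_norm u <= 1 -> frobenius_norm v <= 1 ->
  exists c c', [/\ in_net c, in_net c' &
    (u^T *m A *m v) 0 0 <= ((net_point c)^T *m A *m net_point c') 0 0].
Proof.
move=> u1 v1.
have [c cN hc] := net_rounding (fun a => (A *m v) a 0) u1.
have [c' c'N hc'] := net_rounding (fun b => ((net_point c)^T *m A) 0 b) v1.
exists c, c'; split => //.
apply: (@le_trans _ _ (((net_point c)^T *m A *m v) 0 0)).
  rewrite -!mulmxA mxE [leRHS]mxE.
  under eq_bigr do rewrite mxE mulrC.
  by under [leRHS]eq_bigr do rewrite mxE mulrC.
by rewrite mxE [leRHS]mxE.
Qed.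

(** For even [l] all terms of the double sum are nonnegative, so its l-th root [s] bounds the form
    at every pair of net points and hence the operator norm. *)
Lemma trace_expr_le_net (A : 'M[R]_r) l : (0 < l)%N -> ~~ odd l ->
  \tr (A ^+ l) <= r%:R * \sum_(c | in_net c) \sum_(c' | in_net c')
    ((net_point c)^T *m A *m net_point c') 0 0 ^+ l.
Proof.
move=> l0 evl; set Q := \sum_(c | _) _.
have pos (t : R) : 0 <= t ^+ l by exact: exprn_even_ge0.
have Q0 : 0 <= Q by apply: sumr_ge0 => c _; apply: sumr_ge0 => c' _.
pose s : R := Q `^ (l%:R^-1).
have sl : s ^+ l = Q.
  by rewrite -powR_mulrn ?powR_ge0 // -powRrM mulVf ?pnatr_eq0 -?lt0n // powRr1.
rewrite -sl; apply: trace_expr_bound; first exact: powR_ge0.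
move=> u v u1 v1; have [c [c' [cN c'N h]]] := bilinear_le_net A u1 v1.
apply: (le_trans h); set t := (_ *m _) 0 0.
have [t0|t0] := leP t 0; first by rewrite (le_trans t0) // powR_ge0.
rewrite -(@ler_pXn2r _ l) ?nnegrE ?powR_ge0 ?(ltW t0) // sl.
rewrite /Q (bigD1 c) //= (bigD1 c') //= -addrA lerDl addr_ge0 //.
  by apply: sumr_ge0 => e _.
by apply: sumr_ge0 => e _; apply: sumr_ge0 => e' _.
Qed.
End Net.

(** * A symmetric random matrix with independent entries *)

Section WignerComparison.
Context {R : realType}.

Definition sort_edge {r : nat} (e : 'I_r * 'I_r) : 'I_r * 'I_r :=
  if (e.1 <= e.2)%N then e else (e.2, e.1).

Lemma same_edge_sort r (e f : 'I_r * 'I_r) :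
  same_edge e f = (sort_edge f == sort_edge e).
Proof.
case: e f => a b [c d]; rewrite /same_edge /sort_edge /=.
by case: (leqP a b) => ab; case: (leqP c d) => cd; rewrite !xpair_eqE -!val_eqE /=; lia.
Qed.

Lemma sqr_sum_le_card (I : finType) (P : pred I) (z : I -> R) :
  (\sum_(i | P i) z i) ^+ 2 <= #|P|%:R * \sum_(i | P i) z i ^+ 2.
Proof.
have := cauchy_schwarz (fun i => (P i)%:R : R) (fun i => (P i)%:R * z i).
have -> : \sum_i (P i)%:R * ((P i)%:R * z i) = \sum_(i | P i) z i.
  by rewrite [RHS]big_mkcond; apply: eq_bigr => i _; case: (P i); rewrite ?mul1r ?mul0r.
have -> : \sum_i (P i)%:R ^+ 2 = #|P|%:R :> R.
  by rewrite -sum1_card natr_sum [RHS]big_mkcond; apply: eq_bigr => i _; rewrite unfold_in; case: (P i); rewrite ?expr1n ?expr0n.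
have -> : \sum_i ((P i)%:R * z i) ^+ 2 = \sum_(i | P i) z i ^+ 2.
  by rewrite [RHS]big_mkcond; apply: eq_bigr => i _; case: (P i); rewrite ?mul1r ?mul0r ?expr0n.
by [].
Qed.

Lemma card_sort_edge_fiber r (f : 'I_r * 'I_r) :
  (#|[pred e | sort_edge e == f]| <= 2)%N.
Proof.
apply: (@leq_trans #|[set f; (f.2, f.1)]%SET|); last by rewrite cards2; case: (_ != _).
apply: subset_leq_card; apply/fintype.subsetP => e; rewrite !inE => /eqP <-.
by rewrite /sort_edge; case: ifP => _; rewrite ?eqxx //= -surjective_pairing eqxx orbT.
Qed.

Section Moments.
Variable l : nat.
Hypotheses (l_gt0 : (0 < l)%N) (l_even : ~~ odd l).
Let r := (2 * l)%N.
Let Om : finType := ('I_3 * 'I_l.+1)%type.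
Let E : finType := ('I_r * 'I_r)%type.
Let mean := @prod_mean R E Om (@law_prob R l).

Definition wigner (phi : {ffun E -> Om}) : 'M[R]_r :=
  \matrix_(a, b) law_val (phi (sort_edge (a, b))).

(** Grouping the steps by undirected edge factorizes both sides, and the factors are compared by
    [law_moment]. This applies because a multiplicity never exceeds the length of the walk. *)
Lemma walk_weight_le_wigner (s : seq 'I_r) : (size s <= l)%N ->
  walk_weight moment_root s <= mean (fun phi => cyc_prod (wigner phi) s).
Proof.
move=> sl; set cnt := fun f => count (fun e => sort_edge e == f) (cyc s).
have -> : walk_weight moment_root s = \prod_f (@moment_root R (cnt f)) ^+ cnt f.
  rewrite -(prod_count (fun f => @moment_root R (cnt f)) sort_edge (cyc s)).
  apply: eq_bigr => e _; congr moment_root; apply: eq_count => f.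
  by rewrite same_edge_sort.
have -> : mean (fun phi => cyc_prod (wigner phi) s) =
    mean (fun phi => \prod_f law_val (phi f) ^+ cnt f).
  apply: eq_bigr => phi _; congr (_ * _).
  rewrite -(prod_count (fun f => law_val (phi f)) sort_edge (cyc s)).
  by apply: eq_bigr => e _; rewrite mxE -surjective_pairing.
rewrite /mean (prod_mean_prod (@law_prob R l) (fun f o => law_val o ^+ cnt f)).
apply: ler_prod => f _; rewrite exprn_ge0 ?moment_root_ge0 //=.
apply: law_moment; apply: leq_trans (count_size _ _) _.
by rewrite /cyc size_zip size_rot minnn.
Qed.

(** The form is linear in the independent coordinates. A coordinate feeds at most two matrix
    positions, which costs a factor 2 by Cauchy-Schwarz; with both squared norms at most 4 the
    squared coefficients sum to at most 2 * 4 * 4 = 32. *)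
Lemma wigner_form_moment (c c' : net_index r) : in_net c -> in_net c' ->
  mean (fun phi => (((net_point c)^T *m wigner phi *m net_point c') 0 0 : R) ^+ l) <=
  2 * Num.sqrt l%:R ^+ l * expR (576 * 32) ^+ l.
Proof.
move=> cN c'N; have r_gt0 : (0 < r)%N by rewrite /r; lia.
set x := net_point c; set y := net_point c'.
pose coef (f : E) : R := \sum_(e : E | sort_edge e == f) x e.1 0 * y e.2 0.
have -> : mean (fun phi => ((x^T *m wigner phi *m y) 0 0 : R) ^+ l) =
    mean (fun phi => (\sum_f coef f * law_val (phi f)) ^+ l).
  apply: eq_bigr => phi _; congr (_ * _ ^+ _).
  transitivity (\sum_(e : E) x e.1 0 * y e.2 0 * law_val (phi (sort_edge (e.1, e.2)))).
    rewrite -(pair_bigA _ (fun a b => x a 0 * y b 0 * law_val (phi (sort_edge (a, b))))) /=.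
    rewrite mxE exchange_big; apply: eq_bigr => b _; rewrite mxE mulr_suml.
    by apply: eq_bigr => a _; rewrite !mxE; ring.
  under eq_bigr do rewrite -surjective_pairing.
  rewrite (partition_big sort_edge xpredT) //=; apply: eq_bigr => f _.
  by rewrite mulr_suml; apply: eq_bigr => e /eqP->.
have mgf (z : R) := @law_mgf R l z l_gt0.
apply: (prod_mean_linear_moment (@law_prob_ge0 R l) l_gt0 l_even (ler0n _ _) mgf).
apply: (@le_trans _ _ (\sum_f 2 * \sum_(e : E | sort_edge e == f) (x e.1 0 * y e.2 0) ^+ 2)).
  apply: ler_sum => f _; apply: (le_trans (sqr_sum_le_card _ _)).
  apply: ler_wpM2r; first by apply: sumr_ge0 => e _; exact: sqr_ge0.
  by rewrite (ler_nat _ _ 2) card_sort_edge_fiber.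
rewrite -mulr_sumr.
have -> : \sum_f \sum_(e : E | sort_edge e == f) (x e.1 0 * y e.2 0) ^+ 2 =
    (\sum_a x a 0 ^+ 2) * (\sum_b y b 0 ^+ 2).
  transitivity (\sum_(e : E) (x e.1 0 * y e.2 0) ^+ 2).
    by rewrite [RHS](partition_big sort_edge xpredT).
  rewrite -(pair_bigA _ (fun a b => (x a 0 * y b 0) ^+ 2)) /= mulr_suml.
  apply: eq_bigr => a _; rewrite mulr_sumr; apply: eq_bigr => b _.
  by rewrite exprMn.
have h1 := @net_point_norm R _ r_gt0 _ cN; have h2 := @net_point_norm R _ r_gt0 _ c'N.
have : (\sum_a x a 0 ^+ 2) * (\sum_b y b 0 ^+ 2) <= 4 * 4.
  by apply: ler_pM => //; apply: sumr_ge0 => a _; exact: sqr_ge0.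
by lra.
Qed.

(** Per unit of [l]: two nets of at most 64^(2l) points each give 64^4, and the moment of one form
    gives the exponential. *)
Definition wigner_const : R := 64 ^+ 4 * expR (576 * 32).

Lemma walk_weight_sum_le :
  walk_sum l (@walk_weight R _ moment_root) ([::] : seq 'I_r) <=
  r%:R * (2 * (wigner_const * Num.sqrt l%:R) ^+ l).
Proof.
have r_gt0 : (0 < r)%N by rewrite /r; lia.
apply: (@le_trans _ _ (walk_sum l (fun s => mean (fun phi => cyc_prod (wigner phi) s)) [::])).
  by apply: walk_sum_le => s ss; apply: walk_weight_le_wigner; rewrite ss.
rewrite -(prod_mean_walk_sum _ _ (fun s phi => cyc_prod (wigner phi) s)).
apply: (@le_trans _ _ (mean (fun phi => r%:R * \sum_(c : net_index r | in_net c)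
    \sum_(c' : net_index r | in_net c')
    (((net_point c)^T *m wigner phi *m net_point c') 0 0 : R) ^+ l))).
  apply: prod_mean_le => [w|phi]; first exact: law_prob_ge0.
  have -> : walk_sum l (cyc_prod (wigner phi)) [::] = \tr (wigner phi ^+ l).
    by rewrite -(prednK l_gt0) trace_expr.
  exact: trace_expr_le_net.
rewrite /mean prod_meanZ ler_wpM2l // prod_mean_sum.
set K := 2 * Num.sqrt l%:R ^+ l * expR (576 * 32) ^+ l : R.
have K0 : 0 <= K by rewrite !mulr_ge0 ?exprn_ge0 ?sqrtr_ge0 ?expR_ge0.
apply: (@le_trans _ _ (\sum_(c : net_index r | in_net c) \sum_(c' : net_index r | in_net c') K)).
  by apply: ler_sum => c cN; rewrite prod_mean_sum; apply: ler_sum => c' c'N; exact: wigner_form_moment.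
have -> : \sum_(c : net_index r | in_net c) \sum_(c' : net_index r | in_net c') K =
    (#|@in_net r|%:R * #|@in_net r|%:R) * K.
  by rewrite !sumr_const -mulrA !mulr_natl.
have -> : 2 * (wigner_const * Num.sqrt l%:R) ^+ l = (64 ^+ r * 64 ^+ r) * K.
  have e4 : (64 ^+ 4) ^+ l = 64 ^+ r * 64 ^+ r :> R.
    by rewrite -exprM -exprD; congr (_ ^+ _); rewrite /r; lia.
  rewrite /K /wigner_const [in LHS]exprMn [in LHS]exprMn e4.
  by ring.
by rewrite ler_wpM2r // ler_pM // card_net.
Qed.
End Moments.

End WignerComparison.

Local Open Scope classical_set_scope.
Local Open Scope ring_scope.

(** * Independence and expectations of products *)

Section IndependentProducts.
Context {disp : measure_display} {T : measurableType disp} {R : realType}.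
Variable P : probability T R.

(** Independence enters only through the events of [X] tested against the integral of [g], the form
    in which an induction over factors supplies it. Simple functions and monotone convergence extend
    it to [X]. *)
Lemma integral_indep_mul (X g : T -> R) :
  measurable_fun setT X -> measurable_fun setT g ->
  (forall t, 0 <= X t) -> (forall t, 0 <= g t) ->
  (\int[P]_t (g t)%:E < +oo)%E ->
  (forall B, measurable B ->
    (\int[P]_t (\1_(X @^-1` B) t * g t)%:E = P (X @^-1` B) * \int[P]_t (g t)%:E)%E) ->
  (\int[P]_t (X t * g t)%:E = \int[P]_t (X t)%:E * \int[P]_t (g t)%:E)%E.
Proof.
move=> mX mg X0 g0 gfin H.
have c0 : (0 <= \int[P]_t (g t)%:E)%E by apply: integral_ge0 => t _; rewrite lee_fin.
have cfin : (\int[P]_t (g t)%:E)%E \is a fin_num by rewrite ge0_fin_numE.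
(* Approximating the positive part on the real line and composing with [X >= 0] yields simple
   functions of [X], whose level sets are events of [X]. *)
pose f0 (r : R) : \bar R := (Num.max r 0)%:E.
have mf0 : measurable_fun [set: R] f0.
  by apply/measurable_EFinP; apply: measurable_maxr.
pose h := nnsfun_approx measurableT mf0.
have hcvg t : (h n (X t))%:E @[n --> \oo] --> (X t)%:E.
  have := @cvg_nnsfun_approx _ _ _ _ measurableT f0 mf0 _ (X t) Logic.I.
  rewrite /f0 (max_idPl (X0 t)); apply.
  by move=> x _; rewrite lee_fin le_max lexx orbT.
have hnd t : {homo (fun n => h n (X t)) : m n / (m <= n)%N >-> m <= n}.
  by move=> m n mn; have /lefP := nd_nnsfun_approx measurableT mf0 mn; apply.
have h0 n t : 0 <= h n (X t) by [].
have mh n : measurable_fun setT (fun t => h n (X t)) by exact: measurableT_comp.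
have simple n : (\int[P]_t (h n (X t) * g t)%:E =
    \int[P]_t (h n (X t))%:E * \int[P]_t (g t)%:E)%E.
  have mpre y : measurable (X @^-1` (h n @^-1` [set y])).
    by rewrite -[X in measurable X]setTI; apply: mX => //; rewrite -[X in measurable X]setTI; exact: measurable_funTS.
  have mi y : measurable_fun [set: T] (fun t => \1_(h n @^-1` [set y]) (X t) : R).
    exact: (measurable_indic (mpre y)).
  have yy y t : 0 <= y * \1_(X @^-1` (h n @^-1` [set y])) t.
    rewrite indicE; case: (boolP (t \in _)) => ht; rewrite ?mulr0 // mulr1.
    by move: ht; rewrite inE /= => <-.
  have S1 : (\int[P]_t (h n (X t))%:E =
      \sum_(y \in range (h n)) y%:E * P (X @^-1` (h n @^-1` [set y])))%E.
    under eq_integral do rewrite fimfunE -fsumEFin//.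
    rewrite ge0_integral_fsum//; last 2 first.
    - move=> y; apply/measurable_EFinP/measurable_funM => //; exact: mi.
    - by move=> y t _; rewrite lee_fin; exact: yy.
    apply: eq_fsbigr => y; rewrite inE => -[x _ <-{y}].
    under eq_integral do rewrite EFinM.
    rewrite ge0_integralZl//; last 2 first.
    - by apply/measurable_EFinP; exact: mi.
    - by rewrite lee_fin.
    by have := integral_indic P measurableT (mpre (h n x)); rewrite setIT => <-.
  have S2 : (\int[P]_t (h n (X t) * g t)%:E =
      \sum_(y \in range (h n)) y%:E * (P (X @^-1` (h n @^-1` [set y])) * \int[P]_t (g t)%:E))%E.
    under eq_integral => t _.
      rewrite EFinM fimfunE -fsumEFin// ge0_mule_fsuml; last by move=> y; rewrite lee_fin; exact: yy.
      over.
    rewrite ge0_integral_fsum//; last 2 first.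
    - move=> y; apply/measurable_EFinP/measurable_funM => //; apply: measurable_funM => //; exact: mi.
    - by move=> y t _; rewrite mule_ge0// lee_fin //; exact: yy.
    apply: eq_fsbigr => y; rewrite inE => -[x _ <-{y}].
    rewrite -H; last by rewrite -[X in measurable X]setTI; exact: measurable_funTS.
    under eq_integral do rewrite -EFinM -mulrA EFinM.
    rewrite ge0_integralZl//.
    - by apply/measurable_EFinP/measurable_funM => //; exact: mi.
    - by move=> t _; rewrite lee_fin mulr_ge0.
    - by rewrite lee_fin.
  rewrite S1 S2 ge0_mule_fsuml; last first.
    move=> y; have [[t _ <-]|/= yN] := pselect (range (h n) y); first by rewrite mule_ge0// lee_fin.
    by rewrite (_ : X @^-1` _ = set0) ?measure0 ?mule0 // -subset0 => t /= e; apply: yN; exists (X t).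
  by apply: eq_fsbigr => y _; rewrite muleA.
have L1 : (\int[P]_t (h n (X t) * g t)%:E @[n --> \oo] --> \int[P]_t (X t * g t)%:E)%E.
  have -> : (\int[P]_t (X t * g t)%:E = \int[P]_t limn (fun n => (h n (X t) * g t)%:E))%E.
    apply: eq_integral => t _; apply/esym/cvg_lim => //.
    under eq_fun do rewrite EFinM. rewrite EFinM.
    by apply: cvgeZr => //.
  apply: cvg_monotone_convergence => //.
  - by move=> n; apply/measurable_EFinP/measurable_funM.
  - by move=> n t _; rewrite lee_fin mulr_ge0.
  - by move=> t _ m n mn; rewrite lee_fin ler_wpM2r // hnd.
have L2 : (\int[P]_t (h n (X t))%:E @[n --> \oo] --> \int[P]_t (X t)%:E)%E.
  have -> : (\int[P]_t (X t)%:E = \int[P]_t limn (fun n => (h n (X t))%:E))%E.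
    by apply: eq_integral => t _; apply/esym/cvg_lim.
  apply: cvg_monotone_convergence => //.
  - by move=> n; apply/measurable_EFinP.
  - by move=> n t _; rewrite lee_fin.
  - by move=> t _ m n mn; rewrite lee_fin hnd.
have L3 : (\int[P]_t (h n (X t) * g t)%:E @[n --> \oo] -->
    \int[P]_t (X t)%:E * \int[P]_t (g t)%:E)%E.
  by under eq_fun do rewrite simple; apply: cvgeZr.
exact: (cvg_unique _ L1 L3).
Qed.


Lemma maxr_subN (x : R) : x = Num.max x 0 - Num.max (- x) 0.
Proof.
have [x0|/ltW x0] := leP 0 x.
  by rewrite (max_idPr _) ?subr0 // oppr_le0.
by rewrite (max_idPl _) ?sub0r ?opprK // oppr_ge0.
Qed.

Section Families.
Context {I : finType}.
Variables (D : {set I}) (F : I -> set (set T)).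
Hypothesis indepF : mutual_indep P D F.

(** Indicators are replaced by functions one index at a time: [S] is the set of indices already
    carrying [f i], the others carrying an event [A i]. For empty [S] the claim is the definition of
    mutual independence. *)
Lemma mutual_indep_prod (f : I -> T -> R) (m : I -> R) :
  (forall i, i \in D -> measurable_fun setT (f i)) ->
  (forall i, i \in D -> forall B, measurable B -> F i (f i @^-1` B)) ->
  (forall i, i \in D -> forall t, 0 <= f i t) ->
  (forall i, i \in D -> \int[P]_t (f i t)%:E = (m i)%:E)%E ->
  (\int[P]_t (\prod_(i in D) f i t)%:E = (\prod_(i in D) m i)%:E)%E.
Proof.
move=> mf Ff f0 fm.
pose val (S : {set I}) (A : I -> set T) i t : R := if i \in S then f i t else \1_(A i) t.
pose mea (S : {set I}) (A : I -> set T) i : R := if i \in S then m i else fine (P (A i)).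
suff Q k (S : {set I}) (A : I -> set T) : #|S| = k -> S \subset D ->
    (forall i, i \in D :\: S -> F i (A i) /\ measurable (A i)) ->
    (\int[P]_t (\prod_(i in D) val S A i t)%:E = (\prod_(i in D) mea S A i)%:E)%E.
  have := Q #|D| D (fun=> set0) erefl (subxx _).
  rewrite finset.setDv => /(_ (fun i => ltac:(by rewrite inE))).
  rewrite /val /mea => h.
  have -> : \prod_(i in D) m i = \prod_(i in D) (if i \in D then m i else fine (P set0)).
    by apply: eq_bigr => i ->.
  rewrite -h; apply: eq_integral => t _; congr EFin.
  by apply: eq_bigr => i ->.
elim: k S A => [|k IH] S A cS SD hA.
  move/eqP: cS; rewrite cards_eq0 => /eqP S0; rewrite {}S0 in SD hA *.
  have hA' i : i \in D -> F i (A i) /\ measurable (A i).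
    by move=> iD; apply: hA; rewrite !inE.
  have mA : measurable (\bigcap_(i in [set` D]) A i).
    by apply: fin_bigcap_measurable => // i iD; have [] := hA' i iD.
  transitivity (P (\bigcap_(i in [set` D]) A i)).
    rewrite -[X in P X]setIT -integral_indic //; apply: eq_integral => t _; congr EFin.
    rewrite indicE; case: (boolP (t \in _)) => ht.
      rewrite big1 // => i iD; rewrite /val inE indicE mem_set //.
      by move: ht; rewrite inE; apply.
    have [i iD Ni] : exists2 i, i \in D & ~ A i t.
      apply: contrapT => h; move/negP: ht; apply; rewrite inE => i /= iD.
      by apply: contrapT => Ni; apply: h; exists i.
    by rewrite (bigD1 i) //= /val inE indicE memNset // mul0r.
  rewrite indepF //; last by move=> i iD; have [] := hA' i iD.
  rewrite -prodEFin; apply: eq_bigr => i iD.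
  by rewrite /mea inE fineK //; have [_ /fin_num_measure ->] := hA' i iD.
have /card_gt0P[j jS] : (0 < #|S|)%N by rewrite cS.
have jD : j \in D by exact: (fintype.subsetP SD).
pose S' := (S :\ j)%SET.
(* Putting the event that [f j] lies in [B] back at the index [j] reduces to [S']; over all [B] this
   is the hypothesis of [integral_indep_mul] for [f j] and the product of the other factors. *)
pose AB (B : set R) i := if i == j then f j @^-1` B else A i.
have S'D : S' \subset D by apply: fintype.subset_trans SD; exact: subD1set.
have mval A' i : i \in D -> (forall i, i \in D :\: S -> measurable (A' i)) ->
    measurable_fun setT (val S A' i).
  rewrite /val => iD mA; case: (boolP (i \in S)) => iS; first exact: mf.
  by apply: measurable_indic; apply: mA; rewrite inE iS iD.
have val0 A' i t : i \in D -> 0 <= val S A' i t.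
  by rewrite /val => iD; case: (i \in S); [exact: f0|rewrite indicE].
have mpre B : measurable B -> measurable (f j @^-1` B).
  by move=> mB; rewrite -[X in measurable X]setTI; exact: mf.
have step (B : set R) : measurable B ->
    (\int[P]_t (\1_(f j @^-1` B) t * \prod_(i in D | i != j) val S A i t)%:E =
    (fine (P (f j @^-1` B)) * \prod_(i in D | i != j) mea S A i)%:E)%E.
  move=> mB; have := IH S' (AB B).
  have cS' : #|S'| = k by move: cS; rewrite (cardsD1 j) jS => -[].
  move=> /(_ cS' S'D) h.
  have {}h := h _.
  transitivity (\int[P]_t (\prod_(i in D) val S' (AB B) i t)%:E)%E.
    apply: eq_integral => t _; congr EFin.
    have vj : val S' (AB B) j t = \1_(f j @^-1` B) t by rewrite /val /AB /S' setD11 eqxx.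
    rewrite [RHS](bigD1 j) //= vj; congr (_ * _).
    by apply: eq_bigr => i /andP[iD ij]; rewrite /val /AB in_setD1 ij (negbTE ij).
  rewrite h.
    have mj : mea S' (AB B) j = fine (P (f j @^-1` B)) by rewrite /mea /AB /S' setD11 eqxx.
    rewrite (bigD1 j) //= mj; congr (_ * _)%:E.
    by apply: eq_bigr => i /andP[iD ij]; rewrite /mea /AB in_setD1 ij (negbTE ij).
  move=> i; rewrite /AB /S' finset.in_setD in_setD1; case: eqVneq => [->|ij] /= hi.
    by split; [exact: Ff|exact: mpre].
  by apply: hA; rewrite finset.in_setD.
have gint : (\int[P]_t (\prod_(i in D | i != j) val S A i t)%:E =
    (\prod_(i in D | i != j) mea S A i)%:E)%E.
  have := step setT measurableT; rewrite preimage_setT probability_setT /= mul1r => <-.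
  by apply: eq_integral => t _; rewrite indicT mul1r.
transitivity (\int[P]_t (f j t * \prod_(i in D | i != j) val S A i t)%:E)%E.
  by apply: eq_integral => t _; rewrite (bigD1 j) //= {1}/val jS.
rewrite integral_indep_mul.
- by rewrite fm // gint -EFinM [in RHS](bigD1 j) //= {2}/mea jS.
- exact: mf.
- under eq_fun do rewrite -big_filter.
  apply: measurable_prod => i; rewrite mem_filter => /andP[/andP[iD _] _].
  apply: mval => // i' hi'.
  by have [] := hA i' hi'.
- by move=> t; exact: f0.
- by move=> t; apply: prodr_ge0 => i /andP[iD _]; exact: val0.
- by rewrite gint ltry.
- move=> B mB; rewrite step // gint EFinM fineK //.
  by rewrite fin_num_measure //; exact: mpre.
Qed.

Lemma adapted_comp (f : T -> R) i (g : R -> R) : measurable_fun [set: R] g ->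
  (forall B, measurable B -> F i (f @^-1` B)) ->
  forall B, measurable B -> F i ((g \o f) @^-1` B).
Proof.
move=> mg hf B mB; rewrite comp_preimage; apply: hf.
by rewrite -[X in measurable X]setTI; exact: mg.
Qed.

Lemma measurable_prod_in (f : I -> T -> R) :
  (forall i, i \in D -> measurable_fun setT (f i)) ->
  measurable_fun setT (fun t => \prod_(i in D) f i t).
Proof.
move=> mf; under eq_fun do rewrite -big_filter.
by apply: measurable_prod => i; rewrite mem_filter => /andP[/mf].
Qed.

(** The nonnegative case applied to the absolute values makes the integral of the product finite. *)
Lemma mutual_indep_integrable (f : I -> T -> R) :
  (forall i, i \in D -> forall B, measurable B -> F i (f i @^-1` B)) ->
  (forall i, i \in D -> P.-integrable setT (EFin \o f i)) ->
  P.-integrable setT (EFin \o (fun t => \prod_(i in D) f i t)).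
Proof.
move=> Ff fi.
have mf i : i \in D -> measurable_fun setT (f i).
  by move=> iD; apply/measurable_EFinP; exact: (measurable_int _ (fi i iD)).
apply/integrableP; split; first by apply/measurable_EFinP; exact: measurable_prod_in.
have -> : (\int[P]_t `|(EFin \o (fun t => \prod_(i in D) f i t)%R) t| =
    \int[P]_t (\prod_(i in D) `|f i t|)%R%:E)%E.
  by apply: eq_integral => t _; rewrite /= normr_prod.
rewrite (@mutual_indep_prod (fun i t => `|f i t|) (fun i => fine (\int[P]_t (`|f i t|)%R%:E)%E)).
- by rewrite ltry.
- by move=> i iD; apply: measurableT_comp => //; exact: mf.
- by move=> i iD; apply: (@adapted_comp (f i) i (fun r : R => `|r|)); [exact: normr_measurable|exact: Ff].
- by [].
- move=> i iD; have /integrableP[_ h] := fi i iD.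
  by rewrite fineK // ge0_fin_numE //; apply: integral_ge0.
Qed.

(** Signs are removed one index at a time by splitting [f j] into positive and negative parts; [S]
    contains the indices whose factor may still change sign. *)
Lemma mutual_indep_prod_integral (f : I -> T -> R) (a : I -> R) :
  (forall i, i \in D -> forall B, measurable B -> F i (f i @^-1` B)) ->
  (forall i, i \in D -> P.-integrable setT (EFin \o f i)) ->
  (forall i, i \in D -> \int[P]_t (f i t)%:E = (a i)%:E)%E ->
  (\int[P]_t (\prod_(i in D) f i t)%:E = (\prod_(i in D) a i)%:E)%E.
Proof.
suff Q k : forall (S : {set I}) (f : I -> T -> R) (a : I -> R), #|S| = k ->
    (forall i, i \in D -> i \notin S -> forall t, 0 <= f i t) ->
    (forall i, i \in D -> forall B, measurable B -> F i (f i @^-1` B)) ->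
    (forall i, i \in D -> P.-integrable setT (EFin \o f i)) ->
    (forall i, i \in D -> \int[P]_t (f i t)%:E = (a i)%:E)%E ->
    (\int[P]_t (\prod_(i in D) f i t)%:E = (\prod_(i in D) a i)%:E)%E.
  by move=> Ff fi fa; apply: (Q #|D| D) => // i ->.
elim: k => [|k IH] S {}f {}a cS f0 Ff fi fa.
  move/eqP: cS; rewrite cards_eq0 => /eqP S0; rewrite {}S0 in f0.
  apply: mutual_indep_prod => //.
    by move=> i iD; apply/measurable_EFinP; exact: (measurable_int _ (fi i iD)).
  by move=> i iD; apply: f0 => //; rewrite inE.
have /card_gt0P[j jS] : (0 < #|S|)%N by rewrite cS.
have cS' : #|(S :\ j)%SET| = k by move: cS; rewrite (cardsD1 j) jS => -[].
have [jD|jND] := boolP (j \in D); last first.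
  apply: (IH (S :\ j)%SET) => // i iD iS; apply: f0 => //.
  by apply: contra iS => iS; rewrite in_setD1 iS andbT; apply: contraNneq jND => <-.
pose g (b : bool) (r : R) : R := if b then Num.max r 0 else Num.max (- r) 0.
have mg b : measurable_fun [set: R] (g b).
  by case: b; apply: measurable_maxr => //; exact: measurable_oppr.
pose fb b i := if i == j then g b \o f j else f i.
have gi b : P.-integrable setT (EFin \o (g b \o f j)).
  apply: (le_integrable measurableT _ _ (fi j jD)).
    apply/measurable_EFinP; apply: measurableT_comp => //.
    by apply/measurable_EFinP; exact: (measurable_int _ (fi j jD)).
  move=> t _ /=; rewrite lee_fin /g.
  by case: b; rewrite ger0_norm ?le_max ?lexx ?orbT // ge_max normr_ge0 ?ler_norm // -normrN ler_norm.
have gfin b : (\int[P]_t (g b (f j t))%:E)%E \is a fin_num by exact: integrable_fin_num (gi b).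
pose ab b i := if i == j then fine (\int[P]_t (g b (f j t))%:E)%E else a i.
have fbi b i : i \in D -> P.-integrable setT (EFin \o fb b i).
  by rewrite /fb => iD; case: (i =P j) => [_|_]; [exact: gi|exact: fi].
have fbF b i : i \in D -> forall B, measurable B -> F i (fb b i @^-1` B).
  rewrite /fb => iD; case: (i =P j) => [->|_]; last exact: Ff.
  by apply: adapted_comp => //; exact: Ff.
have Qb b : (\int[P]_t (\prod_(i in D) fb b i t)%:E = (\prod_(i in D) ab b i)%:E)%E.
  apply: (IH (S :\ j)%SET) => //.
  - move=> i iD; rewrite in_setD1 negb_and negbK /fb; case: (i =P j) => /= [_ _ t|_ iS].
      by rewrite /g; case: b; rewrite le_max lexx orbT.
    exact: f0.
  - exact: fbF.
  - exact: fbi.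
  - move=> i iD; rewrite /fb /ab; case: (i =P j) => [_|_]; last exact: fa.
    by rewrite fineK.
have split t : \prod_(i in D) f i t = \prod_(i in D) fb true i t - \prod_(i in D) fb false i t.
  have E b : \prod_(i in D) fb b i t = g b (f j t) * \prod_(i in D | i != j) f i t.
    rewrite (bigD1 j) //= /fb eqxx; congr (_ * _).
    by apply: eq_bigr => i /andP[_ /negbTE ->].
  rewrite !E -mulrBl (bigD1 j) //=; congr (_ * _); rewrite /g.
  by rewrite -maxr_subN.
have fbI b := mutual_indep_integrable (fbF b) (fbi b).
have -> : (\int[P]_t (\prod_(i in D) f i t)%:E =
    \int[P]_t ((\prod_(i in D) fb true i t)%:E - (\prod_(i in D) fb false i t)%:E))%E.
  by apply: eq_integral => t _; rewrite split EFinB.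
rewrite (integralB measurableT (fbI true) (fbI false)) !Qb -EFinB; congr EFin.
have E b : \prod_(i in D) ab b i = ab b j * \prod_(i in D | i != j) a i.
  rewrite (bigD1 j) //=; congr (_ * _).
  by apply: eq_bigr => i /andP[_ /negbTE]; rewrite /ab => ->.
rewrite !E -mulrBl [in RHS](bigD1 j) //=; congr (_ * _).
rewrite /ab eqxx; apply: EFin_inj; rewrite -fa // EFinB !fineK //.
rewrite -(integralB measurableT (gi true) (gi false)); apply: eq_integral => t _ /=.
rewrite -EFinB; congr EFin; rewrite /g.
by rewrite -maxr_subN.
Qed.

End Families.

End IndependentProducts.

(** * Moments of a sub-Gaussian variable *)

Lemma integral_prob_cst {disp} {T : measurableType disp} {R : realType}
  (P : probability T R) (c : R) : (\int[P]__ c%:E = c%:E)%E.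
Proof. by rewrite integral_cst //= probability_setT mule1. Qed.

Section SubGaussianMoments.
Context {disp : measure_display} {T : measurableType disp} {R : realType}.
Variables (P : probability T R) (X : {RV P >-> R}) (sigma : R).
Hypotheses (sigma_gt0 : 0 < sigma) (subgX : sub_gaussian X sigma).

Lemma sub_gaussian_exp (l : R) :
  (\int[P]_t (expR (l * X t))%:E <= (expR (l ^+ 2 * sigma ^+ 2 / 2))%:E)%E.
Proof.
apply: le_trans (subgX l); rewrite /mmt_gen_fun unlock /=.
by under [leLHS]eq_integral do rewrite mulrC.
Qed.

Let mX : measurable_fun setT X. Proof. exact: measurable_funPT. Qed.

Let mexp (l : R) : measurable_fun setT (fun t => expR (l * X t)).
Proof. by apply: measurableT_comp => //; apply: measurable_funM. Qed.

(** At the parameter sqrt k / sigma both exponential moments equal at most (e^(1/2))^k <= 2^k, and 2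
    * 2^k <= 4^k for k >= 1. *)
Lemma sub_gaussian_moment k :
  (\int[P]_t (`|X t| ^+ k)%:E <= ((4 * sigma * Num.sqrt k%:R) ^+ k)%:E)%E.
Proof.
have [->|k0] := posnP k.
  under eq_integral do rewrite expr0.
  by rewrite expr0 integral_prob_cst.
set q : R := Num.sqrt k%:R.
have q0 : 0 < q by rewrite sqrtr_gt0 ltr0n.
have qq : q ^+ 2 = k%:R by rewrite sqr_sqrtr.
pose c := q / sigma; have c0 : 0 < c by rewrite divr_gt0.
have kc : k%:R / c = sigma * q by rewrite -qq /c; field; rewrite !gt_eqF.
pose K : R := (sigma * q) ^+ k.
have K0 : 0 <= K by rewrite exprn_ge0 // mulr_ge0 // ltW.
apply: (@le_trans _ _ (\int[P]_t (K%:E * ((expR (c * X t))%:E + (expR (- c * X t))%:E)))%E).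
  apply: ge0_le_integral => //.
  - by apply/measurable_EFinP; apply: (measurable_funX k (f := fun t => `|X t|)); exact: measurableT_comp.
  - by apply: measurable_funeM; apply: emeasurable_funD; apply/measurable_EFinP.
  - move=> t _; rewrite -EFinD -EFinM lee_fin.
    by rewrite mulNr /K -kc; exact: normrX_le_expR.
rewrite ge0_integralZl //; last 2 first.
- by apply: emeasurable_funD; apply/measurable_EFinP.
- by move=> t _; rewrite -EFinD lee_fin addr_ge0 ?expR_ge0.
rewrite ge0_integralD //; last 2 first.
- by apply/measurable_EFinP.
- by apply/measurable_EFinP.
have e1 (s : R) : s ^+ 2 = c ^+ 2 -> (\int[P]_t (expR (s * X t))%:E <= (2 ^+ k)%:E)%E.
  move=> sc; apply: (le_trans (sub_gaussian_exp s)); rewrite lee_fin.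
  have -> : s ^+ 2 * sigma ^+ 2 / 2 = k%:R * 2^-1.
    by rewrite sc /c -qq; field; rewrite gt_eqF.
  by rewrite expRM_natl lerXn2r ?nnegrE ?expR_ge0 // expR_half_le2.
have e2 : (\int[P]_t (expR (c * X t))%:E + \int[P]_t (expR (- c * X t))%:E <=
    (2 ^+ k + 2 ^+ k)%:E)%E.
  by rewrite EFinD; apply: leeD; apply: e1; rewrite ?sqrrN.
apply: (le_trans (lee_wpmul2l _ e2)); first by rewrite lee_fin.
rewrite -EFinM lee_fin.
have -> : (4 * sigma * q) ^+ k = K * 4 ^+ k by rewrite /K -exprMn; congr (_ ^+ _); ring.
have -> : 2 ^+ k + 2 ^+ k = 2 ^+ k.+1 :> R by rewrite exprS mulrDl mul1r.
rewrite ler_wpM2l // (_ : 4 = 2 ^+ 2 :> R); last by ring.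
by rewrite -exprM ler_eXn2l ?ltr1n //; lia.
Qed.

Lemma sub_gaussian_integrable k : P.-integrable setT (EFin \o (fun t => X t ^+ k)).
Proof.
apply/integrableP; split; first by apply/measurable_EFinP; exact: measurable_funX.
have -> : (\int[P]_t `|(EFin \o (fun t => X t ^+ k)%R) t| =
    \int[P]_t (`|X t| ^+ k)%R%:E)%E.
  by apply: eq_integral => t _; rewrite /= normrX.
by apply: (le_lt_trans (sub_gaussian_moment k)); rewrite ltry.
Qed.

(** Centering is forced by the exponential bound: 1 + l a <= exp (l^2 sigma^2 / 2) for all l, where
    a is the mean, and for small l the right side has no first-order term. *)
Lemma sub_gaussian_mean : (\int[P]_t (X t)%:E = 0)%E.
Proof.
have iX : P.-integrable setT (EFin \o X) := sub_gaussian_integrable 1.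
have fX : (\int[P]_t (X t)%:E)%E \is a fin_num by exact: integrable_fin_num iX.
rewrite -(fineK fX); set a := fine _; congr EFin.
have h (l : R) : 1 + l * a <= expR (l ^+ 2 * sigma ^+ 2 / 2).
  rewrite -lee_fin; apply: le_trans (sub_gaussian_exp l).
  have -> : ((1 + l * a)%:E = \int[P]_t (1 + l * X t)%:E)%E.
    under eq_integral do rewrite EFinD EFinM.
    rewrite integralD //; last 2 first.
    - exact: finite_measure_integrable_cst.
    - exact: integrableZl.
    rewrite integral_prob_cst integralZl //.
    by rewrite -(fineK fX) -/a.
  have [i1|i1] := pselect (P.-integrable setT (EFin \o (fun t => expR (l * X t)))); last first.
    exfalso; apply: i1; apply/integrableP; split; first by apply/measurable_EFinP.
    under eq_integral do rewrite /= ger0_norm ?expR_ge0 //.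
    by apply: (le_lt_trans (sub_gaussian_exp l)); rewrite ltry.
  apply: le_integral => //.
    have -> : (fun t => (1 + l * X t)%:E) = (fun t => (1%:E + l%:E * (X t)%:E)%E).
      by apply/funext => t; rewrite EFinD EFinM.
    apply: integrableD => //; first exact: finite_measure_integrable_cst.
    exact: integrableZl.
  by move=> t _; rewrite lee_fin expR_ge1Dx.
apply/eqP; apply: contraT => a0.
(* The test value is l = s a, with s small enough for s sigma^2 <= 1/2 and s |a| sigma <= 1. The
   left side then gains s a^2 over 1, the right side at most half of it. *)
pose s := (2 * sigma ^+ 2 + `|a| * sigma + 1)^-1.
have an : 0 < `|a| by rewrite normr_gt0.
have Dp : 0 < 2 * sigma ^+ 2 + `|a| * sigma + 1.
  by rewrite ltr_wpDl // addr_ge0 ?mulr_ge0 ?sqr_ge0 // ltW.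
have sp : 0 < s by rewrite invr_gt0.
have s1 : s * (2 * sigma ^+ 2 + `|a| * sigma + 1) = 1 by rewrite mulVf // gt_eqF.
have s2 : s * sigma ^+ 2 <= 2^-1.
  have : 0 <= s * (`|a| * sigma) by rewrite !mulr_ge0 // ltW.
  lra.
have s3 : s * (`|a| * sigma) <= 1.
  have : 0 <= s * sigma ^+ 2 by rewrite mulr_ge0 ?sqr_ge0 // ltW.
  lra.
have s30 : 0 <= s * (`|a| * sigma) by rewrite !mulr_ge0 // ltW.
pose y := (s * (`|a| * sigma)) ^+ 2 / 2.
have y1 : y <= 2^-1.
  have : (s * (`|a| * sigma)) ^+ 2 <= 1 by rewrite expr_le1.
  by rewrite /y; lra.
have y0 : 0 <= y by rewrite divr_ge0 ?sqr_ge0.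
have ey : expR y <= 1 + 2 * y.
  have h1 := expR_ge1Dx (- y); rewrite expRN in h1.
  have ep := expR_gt0 y.
  have : (1 - y) * expR y <= 1 by rewrite -ler_pdivlMr // mul1r.
  have : expR y * y <= expR y * 2^-1 by rewrite ler_wpM2l // ltW.
  move=> g1 g2.
  have g3 : expR y <= 2 by lra.
  have : expR y * y <= 2 * y by rewrite ler_wpM2r.
  lra.
have := h (s * a).
have -> : (s * a) ^+ 2 * sigma ^+ 2 / 2 = y.
  by rewrite /y !exprMn real_normK ?num_real //; ring.
move=> /le_trans/(_ ey).
have -> : 2 * y = s * sigma ^+ 2 * (s * a ^+ 2).
  by rewrite /y !exprMn real_normK ?num_real //; field.
have -> : s * a * a = s * a ^+ 2 by ring.
have sa : 0 < s * a ^+ 2 by rewrite mulr_gt0 // exprn_even_gt0.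
have : s * sigma ^+ 2 * (s * a ^+ 2) <= 2^-1 * (s * a ^+ 2) by rewrite ler_wpM2r // ltW.
lra.
Qed.

Lemma sub_gaussian_moment_root k :
  (`|\int[P]_t (X t ^+ k)%:E| <= ((4 * sigma * moment_root k) ^+ k)%:E)%E.
Proof.
rewrite /moment_root; case: eqVneq => [->|k1].
  by rewrite sub_gaussian_mean abse0 lee_fin mulr0 expr1.
apply: le_trans (sub_gaussian_moment k).
apply: (le_trans (le_abse_integral _ _ _)) => //.
  by apply/measurable_EFinP; exact: measurable_funX.
by under eq_integral do rewrite /= normrX.
Qed.

End SubGaussianMoments.

(** * Walks in the noise matrix *)

(** Taking the generated sigma-algebra as the measurable structure of [T] turns membership in it
    into ordinary measurability, so the closure properties of measurable functions apply. *)
Lemma sub_g_sigma_algebra_measurable {disp disp'} {T : measurableType disp}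
    {U : measurableType disp'} (G : set (set T)) (X : T -> U) :
  preimage_set_system setT X measurable `<=` G ->
  measurable_fun (setT : set (g_sigma_algebraType G)) X.
Proof.
move=> XG _ B mB; apply: sub_sigma_algebra; apply: XG.
by exists B.
Qed.

Lemma g_sigma_algebra_preimage {disp disp'} {T : measurableType disp}
    {U : measurableType disp'} (G : set (set T)) (X : T -> U) B :
  measurable_fun (setT : set (g_sigma_algebraType G)) X -> measurable B ->
  <<s G >> (X @^-1` B).
Proof. by move=> mX mB; rewrite -[X in <<s G >> X]setTI; exact: mX. Qed.

Section NoiseProducts.
Context {disp : measure_display} {T : measurableType disp} {R : realType}.
Variable P : probability T R.
Context {n d : nat}.
Variables (w : 'I_n -> 'I_n -> {RV P >-> bool})
  (Theta : 'I_n -> 'I_n -> 'I_d -> 'I_d -> {RV P >-> R}) (sigma : R).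
Hypotheses (sigma_gt0 : 0 < sigma) (noise : sub_gaussian_noise w Theta sigma).

Definition entry_index : finType := (('I_n * 'I_n) * ('I_d * 'I_d))%type.
Definition entry (f : entry_index) (t : T) : R := Theta f.1.1 f.1.2 f.2.1 f.2.2 t.

Section Powers.
Variable K : entry_index -> nat.

Let a (f : entry_index) : R := fine (\int[P]_t (entry f t ^+ K f)%:E)%E.
(** Independence is given in two layers, entries within one noise matrix and matrices across edges.
    Products of entries are grouped accordingly, and the product rule is applied once per layer. *)
Let block_prod (e : 'I_n * 'I_n) (t : T) : R :=
  \prod_(kl in [set: 'I_d * 'I_d]%SET) entry (e, kl) t ^+ K (e, kl).

Let upperE (e : 'I_n * 'I_n) : (e \in upper) = (e.1 < e.2)%N.
Proof. by rewrite inE. Qed.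

Let entry_integrable e kl : e \in upper ->
  P.-integrable setT (EFin \o (fun t => entry (e, kl) t ^+ K (e, kl))).
Proof.
rewrite upperE => eu.
by have := sub_gaussian_integrable sigma_gt0 (noise_entries_sub_gaussian noise eu kl.1 kl.2) (K (e, kl)).
Qed.

Let entry_fin e kl : e \in upper ->
  (\int[P]_t (entry (e, kl) t ^+ K (e, kl))%:E = (a (e, kl))%:E)%E.
Proof.
by move=> eu; rewrite /a fineK //; exact: integrable_fin_num (entry_integrable kl eu).
Qed.

Let entry_le e kl : e \in upper ->
  `|a (e, kl)| <= (4 * sigma * moment_root (K (e, kl))) ^+ K (e, kl).
Proof.
move=> eu; rewrite -lee_fin -abse_EFin -entry_fin //.
move: eu; rewrite upperE => eu.
exact: (sub_gaussian_moment_root sigma_gt0 (noise_entries_sub_gaussian noise eu kl.1 kl.2)).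
Qed.

Let entry_adapted e kl B : measurable B ->
  preimage_set_system setT (entry (e, kl)) measurable
    ((fun t => entry (e, kl) t ^+ K (e, kl)) @^-1` B).
Proof.
move=> mB; exists ((fun x : R => x ^+ K (e, kl)) @^-1` B); last by rewrite setTI.
by rewrite -[X in measurable X]setTI; exact: exprn_measurable.
Qed.

Let block_integrable e : e \in upper -> P.-integrable setT (EFin \o block_prod e).
Proof.
move=> eu; have eu' := eu; rewrite upperE in eu'.
apply: (mutual_indep_integrable (noise_entries_indep noise eu')).
  by move=> kl _ B mB; exact: entry_adapted.
by move=> kl _; exact: entry_integrable.
Qed.

Let block_integral e : e \in upper ->
  (\int[P]_t (block_prod e t)%:E = (\prod_(kl in [set: 'I_d * 'I_d]%SET) a (e, kl))%:E)%E.
Proof.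
move=> eu; have eu' := eu; rewrite upperE in eu'.
apply: (mutual_indep_prod_integral (noise_entries_indep noise eu')).
- by move=> kl _ B mB; exact: entry_adapted.
- by move=> kl _; exact: entry_integrable.
- by move=> kl _; exact: entry_fin.
Qed.

Let block_adapted e B : measurable B -> noise_sigma Theta e (block_prod e @^-1` B).
Proof.
apply: g_sigma_algebra_preimage; rewrite /block_prod.
apply: (measurable_prod_in (T := g_sigma_algebraType _)
  (f := fun kl t => entry (e, kl) t ^+ K (e, kl))) => kl _.
apply: measurable_funX; apply: sub_g_sigma_algebra_measurable.
by move=> A hA; exists kl.
Qed.

Lemma noise_prod_integrable :
  P.-integrable setT (EFin \o (fun t => \prod_(e in upper) block_prod e t)).
Proof.
apply: (mutual_indep_integrable (noise_indep noise)).
  by move=> e _ B mB; exact: block_adapted.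
by move=> e eu; exact: block_integrable.
Qed.

Lemma noise_prod_le :
  (\int[P]_t (\prod_(e in upper) block_prod e t)%:E <=
   (\prod_(e in upper) \prod_(kl in [set: 'I_d * 'I_d]%SET)
     (4 * sigma * moment_root (K (e, kl))) ^+ K (e, kl))%:E)%E.
Proof.
rewrite (mutual_indep_prod_integral (noise_indep noise)
  (a := fun e => \prod_(kl in [set: 'I_d * 'I_d]%SET) a (e, kl))).
- rewrite lee_fin (le_trans (ler_norm _)) // normr_prod.
  apply: ler_prod => e eu; rewrite normr_ge0 normr_prod.
  by apply: ler_prod => kl _; rewrite normr_ge0 entry_le.
- by move=> e _ B mB; exact: block_adapted.
- by move=> e eu; exact: block_integrable.
- by move=> e eu; exact: block_integral.
Qed.

End Powers.

Section Walks.
Variable a : rel 'I_n.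
Hypothesis a_irr : irreflexive a.
Let N := (\sum_(i < n) d)%N.
Notation sig1 := (tagnat.sig1 (p_ := fun _ : 'I_n => d)).
Let sig2 (x : 'I_N) : 'I_d := tagnat.sig2 x.

(** Below the diagonal the block is a transpose, so the inner indices are swapped together with the
    outer ones. *)
Definition entry_id (e : 'I_N * 'I_N) : entry_index :=
  if (sig1 e.1 < sig1 e.2)%N then ((sig1 e.1, sig1 e.2), (sig2 e.1, sig2 e.2))
  else ((sig1 e.2, sig1 e.1), (sig2 e.2, sig2 e.1)).

(** The deviation matrix with the graph frozen to [a]: only the noise remains random. *)
Definition noise_graph (t : T) : 'M[R]_N :=
  \matrix_(x, y) (if a (sig1 x) (sig1 y) then entry (entry_id (x, y)) t else 0).

Lemma sig12_inj (x y : 'I_N) : sig1 x = sig1 y -> sig2 x = sig2 y -> x = y.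
Proof.
move=> e1 e2; apply: tagnat.sig_inj; rewrite !tagnat.sigE12.
by move: e2; rewrite /sig2; case: _ / e1 (tagnat.sig2 y) => z ->.
Qed.

Let adj : rel 'I_N := fun x y => a (sig1 x) (sig1 y).

(** Multiplicities of undirected edges are thus exactly the exponents of the independent noise
    variables. Irreflexivity of [a] excludes steps inside a block, where the two orientations would
    be given different entries. *)
Lemma entry_id_eq e f : adj e.1 e.2 -> adj f.1 f.2 ->
  (entry_id f == entry_id e) = same_edge e f.
Proof.
case: e f => x y [x' y'] /= axy axy'; rewrite /same_edge /entry_id /=.
have neq u v : adj u v -> sig1 u != sig1 v.
  by apply: contraTneq => uv; rewrite /adj uv a_irr.
have pairE u v u' v' : (((sig1 u, sig1 v), (sig2 u, sig2 v)) ==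
    ((sig1 u', sig1 v'), (sig2 u', sig2 v'))) = ((u == u') && (v == v')).
  rewrite !xpair_eqE; apply/idP/idP.
    case/andP=> /andP[/eqP u1 /eqP v1] /andP[/eqP u2 /eqP v2].
    by rewrite (sig12_inj u1 u2) (sig12_inj v1 v2) !eqxx.
  by case/andP=> /eqP-> /eqP->; rewrite !eqxx.
have nxy := neq _ _ axy; have nxy' := neq _ _ axy'.
have lt1 u v : (sig1 u < sig1 v)%N -> (u == v) = false.
  by move=> h; apply/negbTE; apply: contraTneq h => ->; rewrite ltnn.
rewrite -!val_eqE /= in nxy nxy'.
case: (ltnP (sig1 x) (sig1 y)) => h; case: (ltnP (sig1 x') (sig1 y')) => h';
  rewrite pairE !xpair_eqE.
- rewrite [x == x']eq_sym [y == y']eq_sym; case: (boolP (_ && _)) => //= _.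
  by apply/esym/negbTE/negP => /andP[/eqP e1 /eqP e2]; move: h h'; rewrite e1 e2; lia.
- rewrite [x == y']eq_sym [y == x']eq_sym [(y' == x) && _]andbC orbC.
  case: (boolP (_ && _)) => //= _.
  by apply/esym/negbTE/negP => /andP[/eqP e1 /eqP e2]; move: h h' nxy nxy'; rewrite e1 e2; lia.
- rewrite [x == y']eq_sym [y == x']eq_sym orbC.
  rewrite [(y' == x) && _]andbC; case: (boolP (_ && _)) => //= _.
  by apply/esym/negbTE/negP => /andP[/eqP e1 /eqP e2]; move: h h' nxy nxy'; rewrite e1 e2; lia.
- rewrite [x == x']eq_sym [y == y']eq_sym [(x' == x) && _]andbC.
  case: (boolP (_ && _)) => //= _.
  by apply/esym/negbTE/negP => /andP[/eqP e1 /eqP e2]; move: h h' nxy nxy'; rewrite e1 e2; lia.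
Qed.

Lemma entry_id_upper e : adj e.1 e.2 -> (entry_id e).1 \in upper.
Proof.
move=> ae; rewrite inE /entry_id; case: ifP => //= h.
rewrite ltn_neqAle leqNgt h andbT; apply: contraTneq ae => ee.
by rewrite /adj (val_inj ee) a_irr.
Qed.

Let K (s : seq 'I_N) (f : entry_index) : nat := count (fun e => entry_id e == f) (cyc s).

Lemma edge_count0 s e kl : all (fun e => adj e.1 e.2) (cyc s) -> e \notin upper ->
  K s (e, kl) = 0%N.
Proof.
move=> adjs eN; apply/eqP; rewrite -leqn0 leqNgt -has_count; apply/hasPn => x.
move=> /(allP adjs) ax; apply: contra eN => /eqP xe.
by have := entry_id_upper ax; rewrite xe.
Qed.

Lemma cyc_prod_noise s t : all (fun e => adj e.1 e.2) (cyc s) ->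
  cyc_prod (noise_graph t) s =
  \prod_(e in upper) \prod_(kl in [set: 'I_d * 'I_d]%SET) entry (e, kl) t ^+ K s (e, kl).
Proof.
move=> adjs.
transitivity (\prod_(f : entry_index) entry f t ^+ K s f).
  rewrite -(prod_count (fun f => entry f t) entry_id (cyc s)) /cyc_prod.
  rewrite [LHS]big_seq [RHS]big_seq; apply: eq_bigr => e /(allP adjs) ae.
  by rewrite mxE -/(adj e.1 e.2) ae -surjective_pairing.
rewrite -(pair_bigA _ (fun e kl => entry (e, kl) t ^+ K s (e, kl))) /=.
rewrite (bigID (mem upper)) /= [X in _ * X]big1 ?mulr1; last first.
  by move=> e eN; rewrite big1 // => kl _; rewrite edge_count0 ?expr0.
by apply: eq_bigr => e _; apply: eq_bigl => kl; rewrite inE.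
Qed.

Definition walk_bound (s : seq 'I_N) : R :=
  if all (fun e => adj e.1 e.2) (cyc s)
  then (4 * sigma) ^+ size s * walk_weight moment_root s else 0.

Lemma cyc_prod_noise_bound s :
  P.-integrable setT (EFin \o (fun t => cyc_prod (noise_graph t) s)) /\
  (\int[P]_t (cyc_prod (noise_graph t) s)%:E <= (walk_bound s)%:E)%E.
Proof.
rewrite /walk_bound; case: (boolP (all _ _)) => adjs; last first.
  have E t : cyc_prod (noise_graph t) s = 0.
    have /allPn[e es ne] := adjs.
    rewrite /cyc_prod big_seq; apply/eqP; rewrite prodf_seq_eq0; apply/hasP; exists e => //.
    by rewrite es /= mxE -/(adj e.1 e.2) (negbTE ne).
  split.
    have -> : EFin \o (fun t => cyc_prod (noise_graph t) s) = cst 0%E.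
      by apply/funext => t /=; rewrite E.
    exact: integrable0.
  by under eq_integral do rewrite E; rewrite integral0.
have E t := cyc_prod_noise t adjs.
split.
  have -> : (fun t => cyc_prod (noise_graph t) s) = (fun t =>
    \prod_(e in upper) \prod_(kl in [set: 'I_d * 'I_d]%SET) entry (e, kl) t ^+ K s (e, kl)).
    by apply/funext => t; rewrite E.
  exact: noise_prod_integrable.
under eq_integral do rewrite E.
apply: (le_trans (noise_prod_le _)); rewrite lee_fin.
set B := fun f => (4 * sigma * moment_root (K s f)) ^+ K s f.
have -> : \prod_(e in upper) \prod_(kl in [set: 'I_d * 'I_d]%SET) B (e, kl) =
    \prod_(f : entry_index) B f.
  rewrite -(pair_bigA _ (fun e kl => B (e, kl))) /= [RHS](bigID (mem upper)) /=.
  rewrite [X in _ = _ * X]big1 ?mulr1; last first.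
    by move=> e eN; rewrite big1 // => kl _; rewrite /B edge_count0 ?expr0.
  by apply: eq_bigr => e _; apply: eq_bigl => kl; rewrite inE.
rewrite -(prod_count (fun f => 4 * sigma * moment_root (K s f)) entry_id (cyc s)).
rewrite big_split /= big_const_seq count_predT iter_mulr_1.
have -> : size (cyc s) = size s by rewrite /cyc size_zip size_rot minnn.
rewrite /walk_weight [in leLHS]big_seq [in leRHS]big_seq.
rewrite le_eqVlt; apply/orP; left; apply/eqP; congr (_ * _).
apply: eq_bigr => e es; congr moment_root; apply: eq_in_count => f fs.
by apply: entry_id_eq; apply: (allP adjs).
Qed.

End Walks.
End NoiseProducts.

(** * Tail bound for the trace *)

Section IntegralTools.
Context {disp : measure_display} {T : measurableType disp} {R : realType}.
Variable P : probability T R.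

Lemma walk_sum_integral (V : finType) (F : T -> seq V -> R) (G : seq V -> R) j s :
  (forall s, P.-integrable setT (EFin \o F ^~ s) /\
    (\int[P]_t (F t s)%:E <= (G s)%:E)%E) ->
  P.-integrable setT (EFin \o (fun t => walk_sum j (F t) s)) /\
    (\int[P]_t (walk_sum j (F t) s)%:E <= (walk_sum j G s)%:E)%E.
Proof.
move=> FG; elim: j s => [|j IH] s /=; first exact: FG.
have E : EFin \o (fun t => \sum_y walk_sum j (F t) (rcons s y)) =
    (fun t => \sum_y (walk_sum j (F t) (rcons s y))%:E)%E.
  by apply/funext => t /=; rewrite sumEFin.
have I y : P.-integrable setT (fun t => (walk_sum j (F t) (rcons s y))%:E).
  by have [] := IH (rcons s y).
split; first by rewrite E; apply: integrable_sum => // y _; exact: I.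
have -> : (\int[P]_t (\sum_y walk_sum j (F t) (rcons s y))%:E =
    \int[P]_t (\sum_y (walk_sum j (F t) (rcons s y))%:E))%E.
  by apply: eq_integral => t _; rewrite sumEFin.
rewrite integral_sum //.
rewrite -sumEFin; apply: lee_sum => y _.
by have [] := IH (rcons s y).
Qed.

Lemma markov_ge0 (X : T -> R) (B c : R) : measurable_fun setT X ->
  (forall t, 0 <= X t) -> 0 < c -> (\int[P]_t (X t)%:E <= B%:E)%E ->
  ((1 - B / c)%:E <= P [set t | (X t <= c)%R])%E.
Proof.
move=> mX X0 c0 XB; set S := [set t | _].
have mS : measurable S.
  by rewrite -[S]setTI; apply: measurable_fun_le => //; exact: measurable_cst.
have mSc : measurable (~` S) by exact: measurableC.
have h : (c%:E * P (~` S) <= B%:E)%E.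
  apply: le_trans XB.
  have -> : (c%:E * P (~` S) = \int[P]_t (c * \1_(~` S) t)%:E)%E.
    under eq_integral do rewrite EFinM.
    rewrite ge0_integralZl //.
    - by rewrite integral_indic // setIT.
    - by apply/measurable_EFinP; exact: measurable_indic.
    - by rewrite lee_fin ltW.
  apply: ge0_le_integral => //.
  - by move=> t _; rewrite lee_fin mulr_ge0 // ltW.
  - by apply/measurable_EFinP; apply: measurable_funM => //; exact: measurable_indic.
  - by apply/measurable_EFinP.
  - move=> t _; rewrite lee_fin indicE; case: (boolP (t \in _)) => ht; last by rewrite mulr0.
    by rewrite mulr1; move: ht; rewrite inE /S /= => /negP; rewrite -ltNge => /ltW.
have -> : P S = (1 - P (~` S))%E.
  by rewrite -[in LHS](setCK S) probability_setC.
have fS : P (~` S) \is a fin_num by exact: fin_num_measure.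
rewrite EFinB leeB // -(fineK fS) lee_fin ler_pdivlMr //.
by rewrite mulrC -lee_fin EFinM fineK.
Qed.

End IntegralTools.

Section NoiseTrace.
Context {disp : measure_display} {T : measurableType disp} {R : realType}.
Variable P : probability T R.
Context {n d : nat}.
Variables (w : 'I_n -> 'I_n -> {RV P >-> bool})
  (Theta : 'I_n -> 'I_n -> 'I_d -> 'I_d -> {RV P >-> R}) (sigma : R).
Hypotheses (sigma_gt0 : 0 < sigma) (noise : sub_gaussian_noise w Theta sigma).
Variable a : rel 'I_n.
Hypotheses (a_irr : irreflexive a) (a_sym : symmetric a).
Let N := (\sum_(i < n) d)%N.

Lemma noise_graph_sym t : (noise_graph Theta a t)^T = noise_graph Theta a t.
Proof.
apply/matrixP => x y; rewrite !mxE a_sym; case: ifP => // axy; congr (entry _ _ t).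
have neq : val (tagnat.sig1 (p_ := fun _ : 'I_n => d) x) != tagnat.sig1 (p_ := fun _ : 'I_n => d) y.
  by rewrite val_eqE; apply: contraTneq axy => ->; rewrite a_irr.
by rewrite /entry_id /=; case: ltngtP neq.
Qed.

(** The comparison runs with [M] equal to [l] and 2l labels; its factor 2l on the left cancels the
    dimension factor that the trace of the comparison matrix brings in. *)
Lemma noise_trace_mean l : (0 < l)%N -> ~~ odd l ->
  (forall i, #|a i| * d <= l)%N ->
  (\int[P]_t (\tr (noise_graph Theta a t ^+ l))%:E <=
    (N%:R * (2 * (4 * sigma * (wigner_const * Num.sqrt l%:R)) ^+ l))%:E)%E.
Proof.
move=> l0 evl deg.
have /(_ l [::])[_] := walk_sum_integral _ _ (cyc_prod_noise_bound sigma_gt0 noise a_irr).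
have -> : (\int[P]_t (walk_sum l (cyc_prod (noise_graph Theta a t)) [::])%:E =
    \int[P]_t (\tr (noise_graph Theta a t ^+ l))%:E)%E.
  by apply: eq_integral => t _; rewrite -(prednK l0) trace_expr.
move=> /le_trans; apply; rewrite lee_fin.
have s4 : 0 <= 4 * sigma by rewrite mulr_ge0 // ltW.
pose F' (s : seq 'I_(2 * l)) := (4 * sigma) ^+ size s * walk_weight (@moment_root R) s.
have : #|'I_(2 * l)|%:R * walk_sum l.-1.+1 (walk_bound (d := d) sigma a) [::] <=
    #|'I_N|%:R * walk_sum l.-1.+1 F' [::].
  apply: (@walk_sum_compare R 'I_N 'I_(2 * l)
    (fun x y => a (tagnat.sig1 (p_ := fun _ : 'I_n => d) x) (tagnat.sig1 (p_ := fun _ : 'I_n => d) y))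
    l l.-1 (walk_bound (d := d) sigma a) F').
  (* Each neighbouring block offers d vertices, hence the bound [#|a i| * d] on the degrees of the
     graph on nd vertices. *)
  - move=> x; apply: leq_trans (deg (tagnat.sig1 (p_ := fun _ : 'I_n => d) x)).
    rewrite -[X in (_ <= _ * X)%N]card_ord -cardX.
    pose f (y : 'I_N) : 'I_n * 'I_d := (tagnat.sig1 (p_ := fun _ : 'I_n => d) y, tagnat.sig2 (p_ := fun _ : 'I_n => d) y).
    have finj : injective f by move=> y z [e1 e2]; exact: sig12_inj e1 e2.
    rewrite -(fintype.card_image finj); apply: subset_leq_card; apply/fintype.subsetP => z.
    by move=> /fintype.imageP[y ay ->]; rewrite inE /= andbT.
  - by rewrite card_ord; lia.
  - move=> s; rewrite mulr_ge0 ?exprn_ge0 //.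
    by apply: prodr_ge0 => e _; exact: moment_root_ge0.
  - move=> x s np; rewrite /walk_bound; case: ifP => // h'; move: np.
    suff -> : path (fun x y => a (tagnat.sig1 (p_ := fun _ : 'I_n => d) x) (tagnat.sig1 (p_ := fun _ : 'I_n => d) y)) x s by [].
    move: h'; rewrite cyc_cons all_rcons => /andP[_].
    elim: s x => //= y s IHs x /andP[-> hs] /=; exact: IHs.
  - move=> s phi inj_phi; rewrite /walk_bound /F' size_map walk_weight_map //.
    case: ifP => // _; rewrite mulr_ge0 ?exprn_ge0 //.
    by apply: prodr_ge0 => e _; exact: moment_root_ge0.
rewrite prednK // !card_ord => h.
have h2 : walk_sum l F' [::] <= (4 * sigma) ^+ l * ((2 * l)%:R * (2 * (wigner_const * Num.sqrt l%:R) ^+ l)).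
  apply: (@le_trans _ _ (walk_sum l (fun s : seq 'I_(2 * l) => (4 * sigma) ^+ l * walk_weight (@moment_root R) s) [::])).
    by apply: walk_sum_le => s ss; rewrite /F' ss.
  by rewrite walk_sumZ ler_wpM2l ?exprn_ge0 // walk_weight_sum_le.
have l2 : (0 : R) < (2 * l)%:R by rewrite ltr0n muln_gt0.
rewrite -(ler_pM2l l2); apply: (le_trans h).
apply: (le_trans (ler_wpM2l _ h2)) => //.
by rewrite le_eqVlt; apply/orP; left; apply/eqP; rewrite [(4 * sigma * _) ^+ l]exprMn; ring.
Qed.

(** The measurable structure [U] is left free because both that of [T] and the one generated by the
    noise are needed. *)
Lemma noise_graph_expr_measurable {disp'} (U : measurableType disp') (A : U -> 'M[R]_N) k x y :
  (forall x y, measurable_fun setT (fun t => A t x y)) ->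
  measurable_fun setT (fun t => (A t ^+ k) x y).
Proof.
move=> mA; elim: k x y => [|k IH] x y.
  by under eq_fun do rewrite expr0; exact: measurable_cst.
have -> : (fun t => (A t ^+ k.+1) x y) = (fun t => \sum_z A t x z * (A t ^+ k) z y).
  by apply/funext => t; rewrite exprS mxE.
by apply: measurable_sum => z; apply: measurable_funM; [exact: mA|exact: IH].
Qed.

(** Independence from the graph applies to events in the sigma-algebra of the noise, for which
    measurability in [T] is not enough. *)
Lemma noise_trace_adapted l c : all_noise_sigma Theta [set t | \tr (noise_graph Theta a t ^+ l) <= c].
Proof.
set G := \bigcup_(e in [set` upper]) noise_sigma Theta e.
pose U := g_sigma_algebraType G.
have me (e : entry_index) : e.1 \in upper -> measurable_fun (setT : set U) (entry Theta e).
  move=> eu; apply: sub_g_sigma_algebra_measurable => B hB; exists e.1 => //.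
  by apply: sub_sigma_algebra; exists e.2.
have mA x y : measurable_fun (setT : set U) (fun t => noise_graph Theta a t x y).
  under eq_fun do rewrite mxE.
  case: (boolP (a _ _)) => axy; last exact: measurable_cst.
  by apply: me; exact: (entry_id_upper a_irr).
have mt : measurable_fun (setT : set U) (fun t => \tr (noise_graph Theta a t ^+ l)).
  by rewrite /mxtrace; apply: measurable_sum => x; exact: noise_graph_expr_measurable.
rewrite [X in all_noise_sigma _ X](_ : _ = (fun t => \tr (noise_graph Theta a t ^+ l)) @^-1` `]-oo, c]%classic).
  exact: g_sigma_algebra_preimage.
by apply/seteqP; split => t /=; rewrite in_itv.
Qed.

Lemma noise_trace_measurable l : measurable_fun setT (fun t => \tr (noise_graph Theta a t ^+ l)).
Proof.
rewrite /mxtrace; apply: measurable_sum => x; apply: noise_graph_expr_measurable => y z.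
under eq_fun do rewrite mxE.
case: (a _ _); last exact: measurable_cst.
exact: (measurable_funPT (Theta _ _ _ _)).
Qed.

Lemma noise_trace_tail k l c : l = (2 ^ k.+1)%N -> 0 < c ->
  (forall i, #|a i| * d <= l)%N ->
  ((1 - (N%:R * (2 * (4 * sigma * (wigner_const * Num.sqrt l%:R)) ^+ l)) / c)%:E <=
    P [set t | (\tr (noise_graph Theta a t ^+ l) <= c)%R])%E.
Proof.
move=> lk c0 deg; apply: markov_ge0 => //.
- exact: noise_trace_measurable.
(* The trace of the power is nonnegative, as seen from the norm-trace inequality at the vector 0. *)
- move=> t; rewrite lk; apply: (le_trans _ (frobenius_norm_le_trace (x := 0) k (noise_graph_sym t) _)).
    by rewrite exprn_ge0 // frobenius_norm_ge0.
  by rewrite frobenius_norm0.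
- apply: noise_trace_mean => //; first by rewrite lk expn_gt0.
  by rewrite lk expnS mul2n odd_double.
Qed.

End NoiseTrace.

(** * Degrees of the observed graph *)

Section UnionBound.
Context {disp : measure_display} {T : measurableType disp} {R : realType}.
Variable P : probability T R.

Lemma probability_setI_ge (A B : set T) (x y : R) : measurable A -> measurable B ->
  ((1 - x)%:E <= P A)%E -> ((1 - y)%:E <= P B)%E ->
  ((1 - (x + y))%:E <= P (A `&` B))%E.
Proof.
move=> mA mB PA PB.
have fin C : measurable C -> P C = (fine (P C))%:E.
  by move=> mC; rewrite fineK // fin_num_measure.
have h : (P (~` (A `&` B)) <= P (~` A) + P (~` B))%E.
  by rewrite setCI; apply: measureU2; exact: measurableC.
have mAB := measurableI _ _ mA mB.
move: h PA PB; rewrite !probability_setC // (fin _ mA) (fin _ mB) (fin _ mAB).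
by rewrite -!EFinB -EFinD !lee_fin; lra.
Qed.

Lemma probability_bigcap_ge (I : finType) (A : I -> set T) (x : I -> R) :
  (forall i, measurable (A i)) -> (forall i, ((1 - x i)%:E <= P (A i))%E) ->
  ((1 - \sum_i x i)%:E <= P [set t | forall i, A i t])%E.
Proof.
move=> mA PA.
pose B (s : seq I) := \big[setI/setT]_(i <- s) A i.
have -> : [set t | forall i, A i t] = B (index_enum I).
  apply/seteqP; split => t; rewrite /B.
    by move=> h; elim/big_ind : _ => // C D; split.
  by move=> h i; move: h; rewrite (bigD1_seq i) //= ?mem_index_enum ?index_enum_uniq // => -[].
elim: (index_enum I) => [|i s IH].
  by rewrite /B !big_nil subr0 probability_setT.
rewrite /B !big_cons; apply: probability_setI_ge => //.
by elim: (s) => [|j s' IHs]; rewrite ?big_nil // big_cons; exact: measurableI.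
Qed.

End UnionBound.

Section Degrees.
Context {disp : measure_display} {T : measurableType disp} {R : realType}.
Variable P : probability T R.
Context {n : nat}.
Variables (w : 'I_n -> 'I_n -> {RV P >-> bool}) (p : R).
Hypotheses (p01 : 0 < p <= 1) (er : erdos_renyi w p).

Definition adjacency (om : {ffun 'I_n * 'I_n -> bool}) : rel 'I_n := fun i j =>
  if (i < j)%N then om (i, j) else if (j < i)%N then om (j, i) else false.

Definition observed_graph (t : T) : {ffun 'I_n * 'I_n -> bool} :=
  [ffun e : 'I_n * 'I_n => (e.1 < e.2)%N && w e.1 e.2 t].

Lemma adjacency_irr om : irreflexive (adjacency om).
Proof. by move=> i; rewrite /adjacency ltnn. Qed.

Lemma adjacency_sym om : symmetric (adjacency om).
Proof. by move=> i j; rewrite /adjacency; case: ltngtP. Qed.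

Let edge (i j : 'I_n) : 'I_n * 'I_n := if (i < j)%N then (i, j) else (j, i).
Let incident (i : 'I_n) (e : 'I_n * 'I_n) := (e.1 == i) || (e.2 == i).

Let big_incident (V : Type) (idx : V) (op : Monoid.com_law idx) (F : 'I_n * 'I_n -> V) i :
  \big[op/idx]_(e | (e \in upper) && incident i e) F e = \big[op/idx]_(j | j != i) F (edge i j).
Proof.
rewrite (reindex_onto (edge i) (fun e => if e.1 == i then e.2 else e.1)); last first.
  move=> [x y]; rewrite inE /incident /edge /= => /andP[xy].
  have [xi|xi] := eqVneq x i; first by rewrite -xi xy.
  by move=> /= /eqP yi; rewrite -yi ltnNge (ltnW xy).
apply: eq_bigl => j; rewrite inE /incident /edge.
have [ij|ji|ij] := ltngtP i j; rewrite /= ?eqxx ?orbT ?ij ?ji /=.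
- by rewrite -val_eqE /= gtn_eqF.
- have -> : (j == i) = false by apply/negbTE; rewrite -val_eqE /= ltn_eqF.
  by rewrite /= eqxx.
- by rewrite ltnn (val_inj ij) eqxx.
Qed.

Lemma degree_sum t i :
  (#|adjacency (observed_graph t) i|%:R : R) =
  \sum_(e | (e \in upper) && incident i e) (w e.1 e.2 t)%:R.
Proof.
rewrite big_incident -sum1_card natr_sum [LHS]big_mkcond [RHS]big_mkcond.
apply: eq_bigr => j _; rewrite unfold_in /adjacency /edge -val_eqE /=.
by case: ltngtP => /= h; rewrite ?ffunE /= ?h; case: (w _ _ t).
Qed.

(** The degree is a sum of n - 1 independent Bernoulli variables; edges not incident to [i] carry
    the factor 1, so independence can be used over all of [upper]. *)
Lemma degree_mgf i (l : R) :
  (\int[P]_t (expR (l * #|adjacency (observed_graph t) i|%:R))%:E =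
  ((1 + p * (expR l - 1)) ^+ n.-1)%:E)%E.
Proof.
have [ind law] := er.
pose f (e : 'I_n * 'I_n) t : R := if incident i e then expR (l * (w e.1 e.2 t)%:R) else 1.
pose m (e : 'I_n * 'I_n) : R := if incident i e then 1 + p * (expR l - 1) else 1.
have -> : (\int[P]_t (expR (l * #|adjacency (observed_graph t) i|%:R))%:E =
    \int[P]_t (\prod_(e in upper) f e t)%:E)%E.
  apply: eq_integral => t _; congr EFin; rewrite degree_sum mulr_sumr expR_sum.
  by rewrite [LHS]big_mkcondr.
have me e (B : set bool) : measurable (w e.1 e.2 @^-1` B).
  by rewrite -[X in measurable X]setTI; exact: measurable_funPT.
have fE e t : f e t = \1_(w e.1 e.2 @^-1` [set true]) t * (if incident i e then expR l - 1 else 0) + 1.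
  rewrite /f indicE; case: ifP => _; last by rewrite mulr0 add0r.
  case wt : (w e.1 e.2 t).
    by rewrite mem_set //= mul1r mulr1 subrK.
  by rewrite memNset /= ?wt // mul0r add0r mulr0 expR0.
rewrite (mutual_indep_prod (F := fun e => preimage_set_system setT (w e.1 e.2) measurable) ind (m := m)).
- congr EFin; rewrite /m -big_mkcondr big_incident prodr_const.
  by rewrite cardC1 card_ord.
- move=> e _; rewrite (_ : f e = fun t => \1_(w e.1 e.2 @^-1` [set true]) t * (if incident i e then expR l - 1 else 0) + 1).
    by apply: measurable_funD => //; apply: measurable_funM => //; exact: measurable_indic.
  by apply/funext => t; rewrite fE.
- move=> e _ B mB; exists ((fun b : bool => if incident i e then expR (l * b%:R) else 1) @^-1` B) => //.
  by rewrite setTI.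
- by move=> e _ t; rewrite /f; case: ifP => // _; exact: expR_ge0.
- move=> e; rewrite inE => eu; rewrite /m /f; case: ifP => _; last by rewrite integral_prob_cst.
  transitivity (\int[distribution P (w e.1 e.2)]_b (expR (l * b%:R))%:E)%E.
    by rewrite ge0_integral_distribution // => b; rewrite lee_fin expR_ge0.
  rewrite (eq_measure_integral (bernoulli_prob p)); last by move=> A mA _; exact: law.
  have /andP[p0 p1] := p01.
  rewrite integral_bernoulli_prob ?(ltW p0) //.
  by rewrite mulr1 mulr0 expR0 -!EFinM -EFinD; congr EFin; rewrite /unstable.onem; ring.
Qed.

(** The adjacency relation has no loops, whereas the degree in D counts w_ii = 1; hence the 1 in the
    lower bound. *)
Definition good_graph (om : {ffun 'I_n * 'I_n -> bool}) : Prop := forall i,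
  #|adjacency om i|%:R <= 4 * (p * n%:R) /\
  p * n%:R / 4 <= 1 + #|adjacency om i|%:R.

Let mdeg i : measurable_fun setT (fun t => #|adjacency (observed_graph t) i|%:R : R).
Proof.
under eq_fun do rewrite degree_sum -big_filter.
apply: measurable_sum => e.
by apply: (measurableT_comp (f := fun b : bool => b%:R : R)) => //; exact: measurable_funPT.
Qed.

(** Chernoff's bound at the parameter 1/2: since e^(1/2) <= 2, the exponential moment is at most (1
    + p)^(n-1) <= e^(pn), against the threshold e^(2pn). *)
Lemma degree_le i : (0 < n)%N ->
  ((1 - expR (- (p * n%:R)))%:E <= P [set t | (#|adjacency (observed_graph t) i|%:R <= 4 * (p * n%:R))%R])%E.
Proof.
move=> n0; have /andP[p0 p1] := p01.
have := @markov_ge0 _ _ _ P (fun t => expR (2^-1 * #|adjacency (observed_graph t) i|%:R))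
  (expR (p * n%:R)) (expR (2 * (p * n%:R))).
rewrite expR_gt0 -expRB (_ : p * n%:R - 2 * (p * n%:R) = - (p * n%:R)); last by ring.
move=> h; have {h} := h _ _ _ _.
have -> : [set t | (expR (2^-1 * #|adjacency (observed_graph t) i|%:R) <= expR (2 * (p * n%:R)))%R] =
    [set t | (#|adjacency (observed_graph t) i|%:R <= 4 * (p * n%:R) :> R)%R].
  apply/seteqP; split => t /=; rewrite ler_expR; lra.
apply => //.
- by apply: measurableT_comp => //; apply: measurable_funM.
have hn : n%:R = n.-1%:R + 1 :> R by rewrite natr1 prednK.
rewrite degree_mgf lee_fin (_ : p * n%:R = p * n.-1%:R + p); last by rewrite hn; ring.
have e2 := @expR_half_le2 R; have e1 : 1 <= expR (2^-1 : R) by rewrite -expR0 ler_expR.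
apply: (@le_trans _ _ (expR p ^+ n.-1)).
  rewrite lerXn2r ?nnegrE ?expR_ge0 //.
    by rewrite addr_ge0 // mulr_ge0 ?(ltW p0) // subr_ge0.
  apply: le_trans (expR_ge1Dx _); rewrite lerD2l.
  by rewrite -[leRHS]mulr1 ler_wpM2l ?(ltW p0) //; lra.
by rewrite -expRM_natr ler_expR lerDl ltW.
Qed.

(** Chernoff's bound at the parameter -1: since e^-1 <= 1/2, the exponential moment is at most
    e^(-p(n-1)/2) <= e^(1/2 - pn/2), the 1/2 covering the passage from n - 1 to n; the threshold is
    e^(1 - pn/4). *)
Lemma degree_ge i : (0 < n)%N ->
  ((1 - expR (- (p * n%:R / 4)))%:E <= P [set t | (p * n%:R / 4 <= 1 + #|adjacency (observed_graph t) i|%:R)%R])%E.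
Proof.
move=> n0; have /andP[p0 p1] := p01.
have := @markov_ge0 _ _ _ P (fun t => expR (- 1 * #|adjacency (observed_graph t) i|%:R))
  (expR (2^-1 - p * n%:R / 2)) (expR (1 - p * n%:R / 4)).
rewrite expR_gt0 -expRB => h; have {h} := h _ _ _ _.
have -> : [set t | (expR (- 1 * #|adjacency (observed_graph t) i|%:R) <= expR (1 - p * n%:R / 4))%R] =
    [set t | (p * n%:R / 4 <= 1 + #|adjacency (observed_graph t) i|%:R :> R)%R].
  apply/seteqP; split => t /=; rewrite ler_expR; lra.
move=> h; apply: le_trans (h _ _ _ _) => //.
- rewrite lee_fin lerD2l lerN2 ler_expR; lra.
- by apply: measurableT_comp => //; apply: measurable_funM.
rewrite degree_mgf lee_fin.
have e1 : expR (-1 : R) <= 2^-1.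
  by rewrite expRN lef_pV2 ?posrE ?expR_gt0 //; have := expR_ge1Dx (1 : R); lra.
have e0 := expR_ge0 (-1 : R).
apply: (@le_trans _ _ (expR (- (p / 2)) ^+ n.-1)).
  rewrite lerXn2r ?nnegrE ?expR_ge0 //.
    have : p * expR (-1) >= 0 by rewrite mulr_ge0 // ltW.
    lra.
  apply: le_trans (expR_ge1Dx _); rewrite lerD2l.
  have : p * expR (-1) <= p * 2^-1 by rewrite ler_wpM2l // ltW.
  lra.
have hn : n%:R = n.-1%:R + 1 :> R by rewrite natr1 prednK.
by rewrite -expRM_natr ler_expR hn; lra.
Qed.

(** The constant 8 makes e^(-pn/4) at most n^-2; there are two such events at each of n vertices. *)
Lemma good_graph_probability : (0 < n)%N -> 8 * ln n%:R <= p * n%:R ->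
  ((1 - 2 / n%:R)%:E <= P [set t | good_graph (observed_graph t)])%E.
Proof.
move=> n0 pn; have n0' : (0 : R) < n%:R by rewrite ltr0n.
have pn0 : 0 <= p * n%:R by have /andP[p0 _] := p01; rewrite mulr_ge0 // ltW.
have e2 : expR (- (p * n%:R / 4)) <= (n%:R ^+ 2)^-1.
  rewrite expRN lef_pV2 ?posrE ?expR_gt0 ?exprn_gt0 //.
  rewrite -{1}(@lnK _ (n%:R : R)) ?posrE // -expRM_natl ler_expR; lra.
have e1 : expR (- (p * n%:R)) <= (n%:R ^+ 2)^-1.
  by apply: le_trans e2; rewrite ler_expR; lra.
have mle i (c : R) : measurable [set t | (#|adjacency (observed_graph t) i|%:R <= c)%R].
  by rewrite -[X in measurable X]setTI; apply: measurable_fun_le => //; exact: measurable_cst.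
have mge i (c : R) : measurable [set t | (c <= 1 + #|adjacency (observed_graph t) i|%:R)%R].
  rewrite -[X in measurable X]setTI; apply: measurable_fun_le => //.
  by apply: measurable_funD => //; exact: measurable_cst.
have := @probability_bigcap_ge _ _ _ P 'I_n (fun i =>
  [set t | (#|adjacency (observed_graph t) i|%:R <= 4 * (p * n%:R))%R] `&`
  [set t | (p * n%:R / 4 <= 1 + #|adjacency (observed_graph t) i|%:R)%R])
  (fun i => (n%:R ^+ 2)^-1 + (n%:R ^+ 2)^-1).
rewrite sumr_const card_ord.
have -> : ((n%:R ^+ 2)^-1 + (n%:R ^+ 2)^-1) *+ n = 2 / n%:R :> R.
  by rewrite -mulr_natl; field; rewrite gt_eqF.
apply.
- by move=> i; apply: measurableI.
- move=> i; apply: probability_setI_ge => //.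
  + by apply: le_trans (degree_le i n0); rewrite lee_fin lerD2l lerN2.
  + by apply: le_trans (degree_ge i n0); rewrite lee_fin lerD2l lerN2.
Qed.

End Degrees.

(** * Conditioning on the graph; block matrices *)

Section Conditioning.
Context {disp : measure_display} {T : measurableType disp} {R : realType}.
Variable P : probability T R.
Context {n d : nat}.
Variables (w : 'I_n -> 'I_n -> {RV P >-> bool})
  (Theta : 'I_n -> 'I_n -> 'I_d -> 'I_d -> {RV P >-> R}) (sigma : R).
Hypothesis noise : sub_gaussian_noise w Theta sigma.

Lemma observed_graph_fiber om : [set t | observed_graph w t = om] =
  \bigcap_(e in [set: 'I_n * 'I_n]) ((fun t => observed_graph w t e) @^-1` [set om e]).
Proof.
apply/seteqP; split => t /=; first by move=> ht e _; rewrite /= ht.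
by move=> h; apply/ffunP => e; exact: (h e I).
Qed.

Lemma observed_graph_adapted om :
  graph_sigma w [set t | observed_graph w t = om].
Proof.
set G := \bigcup_(e in [set` upper]) preimage_set_system setT (w e.1 e.2 : T -> bool) measurable.
pose U := g_sigma_algebraType G.
rewrite observed_graph_fiber.
apply: (@fin_bigcap_measurable _ U) => // e _.
apply: g_sigma_algebra_preimage => //.
under eq_fun do rewrite ffunE.
case: (boolP (e.1 < e.2)%N) => eu; last exact: measurable_cst.
apply: sub_g_sigma_algebra_measurable => B hB; exists e => //.
by rewrite /= inE.
Qed.

Lemma observed_graph_measurable om : measurable [set t | observed_graph w t = om].
Proof.
rewrite observed_graph_fiber.
apply: fin_bigcap_measurable => // e _.
rewrite -[X in measurable X]setTI.
suff : measurable_fun setT (fun t => observed_graph w t e) by move=> mf; exact: mf.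
under eq_fun do rewrite ffunE.
by case: (e.1 < e.2)%N => //=; [exact: measurable_funPT|exact: measurable_cst].
Qed.

(** The graph takes finitely many values, so conditioning is a finite sum over its fibers, on each
    of which [S om] is independent of the fiber. The final loss is (1 - delta)(1 - eta) >= 1 -
    (delta + eta). *)
Lemma conditional_event (Q : {ffun 'I_n * 'I_n -> bool} -> Prop)
    (S : {ffun 'I_n * 'I_n -> bool} -> set T) (delta eta : R) :
  0 <= eta -> 0 <= delta <= 1 ->
  (forall om, measurable (S om)) ->
  (forall om, all_noise_sigma Theta (S om)) ->
  (forall om, Q om -> ((1 - delta)%:E <= P (S om))%E) ->
  ((1 - eta)%:E <= P [set t | Q (observed_graph w t)])%E ->
  measurable [set t | Q (observed_graph w t) /\ S (observed_graph w t) t] /\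
  ((1 - (delta + eta))%:E <=
    P [set t | Q (observed_graph w t) /\ S (observed_graph w t) t])%E.
Proof.
move=> eta0 /andP[delta0 delta1] mS aS PS Peta.
pose O om := [set t | observed_graph w t = om].
have mO om : measurable (O om) by exact: observed_graph_measurable.
have finQ : finite_set [set om | Q om] by exact: finite_finset.
have E1 : [set t | Q (observed_graph w t)] = \bigcup_(om in [set om | Q om]) O om.
  apply/seteqP; split => t /=; first by move=> h; exists (observed_graph w t).
  by move=> [om /= Qom Ot]; rewrite (Ot : observed_graph w t = om).
have E2 : [set t | Q (observed_graph w t) /\ S (observed_graph w t) t] =
    \bigcup_(om in [set om | Q om]) (S om `&` O om).
  apply/seteqP; split => t /=; first by move=> [h1 h2]; exists (observed_graph w t).
  by move=> [om /= Qom [h Ot]]; rewrite (Ot : observed_graph w t = om).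
have mSO om : measurable (S om `&` O om) by exact: measurableI.
have tO : trivIset [set om | Q om] O.
  by move=> i j _ _ [t [/= <- <-]].
have tSO : trivIset [set om | Q om] (fun om => S om `&` O om).
  by move=> i j _ _ [t [[_ /= <-] [_ /= <-]]].
split; first by rewrite E2; apply: fin_bigcup_measurable.
rewrite E2 measure_fin_bigcup //.
rewrite E1 measure_fin_bigcup // in Peta.
apply: (@le_trans _ _ ((1 - delta)%:E * \sum_(om \in [set om | Q om]) P (O om))%E).
  apply: (@le_trans _ _ ((1 - delta)%:E * (1 - eta)%:E)%E).
    rewrite -EFinM lee_fin.
    have : 0 <= delta * eta by rewrite mulr_ge0.
    lra.
  by rewrite lee_wpmul2l // lee_fin subr_ge0.
rewrite ge0_mule_fsumr; last by move=> om; exact: measure_ge0.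
apply: lee_fsum => // om /= Qom.
rewrite (noise_indep_graph noise); [|exact: aS|exact: observed_graph_adapted].
by rewrite lee_wpmul2r //; exact: PS.
Qed.

Lemma deviation_noise_graph t :
  deviation w Theta t = noise_graph Theta (adjacency (observed_graph w t)) t.
Proof.
apply/matrixP => x y; rewrite !mxE /adjacency /entry_id /= !ffunE /=.
case: ltngtP => h; rewrite !mxE /weight /= ?h.
- by case: (w _ _ t); rewrite ?mul1r ?mul0r.
- by rewrite ltnNge (ltnW h) /=; case: (w _ _ t); rewrite ?mul1r ?mul0r.
- by [].
Qed.

Lemma degree_adjacency t i :
  degree w t i = 1 + #|adjacency (observed_graph w t) i|%:R.
Proof.
rewrite /degree (bigD1 i) //= {1}/weight ltnn; congr (_ + _).
rewrite -sum1_card natr_sum [LHS]big_mkcond [RHS]big_mkcond; apply: eq_bigr => j _.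
rewrite unfold_in /adjacency /weight -val_eqE /=.
by case: ltngtP => /= h; rewrite ?ffunE /= ?h; case: (w _ _ t).
Qed.

End Conditioning.

Section Blocks.
Context {R : realType} {n d : nat}.
Notation sig1 := (tagnat.sig1 (p_ := fun _ : 'I_n => d)).

Lemma mxdiag_scalar (c : 'I_n -> R) :
  \mxdiag_(i < n) ((c i)%:M : 'M[R]_d) = diag_mx (\row_x c (sig1 x)).
Proof.
apply/matrixP => x y; rewrite !mxE.
case: eqP => [e|ne]; last first.
  rewrite !mxE; case: eqP => // xy; case: ne; by rewrite xy.
rewrite conform_mx_id mxE; congr (_ *+ nat_of_bool _).
by apply/idP/eqP => [/eqP h|->]; [exact: sig12_inj e h|rewrite eqxx].
Qed.

Lemma mul_invmx_mxdiag (c : 'I_n -> R) m (Z : 'M[R]_(\sum_(i < n) d, m)) :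
  (forall i, c i != 0) ->
  invmx (\mxdiag_(i < n) ((c i)%:M : 'M[R]_d)) *m Z = \matrix_(x, j) ((c (sig1 x))^-1 * Z x j).
Proof.
move=> c0; rewrite mxdiag_scalar.
set D := diag_mx _; pose D' := diag_mx (\row_x (c (sig1 x))^-1).
have DD' : D *m D' = 1%:M.
  rewrite mulmx_diag; apply/matrixP => x y; rewrite !mxE divff //.
have [uD _] := mulmx1_unit DD'.
have -> : invmx D = D' by rewrite -[LHS]mulmx1 -DD' mulKmx.
by rewrite mul_diag_mx; apply/matrixP => x j; rewrite !mxE.
Qed.

Lemma sqr_frobenius_norm_block (Y : block_column R n d) :
  frobenius_norm Y ^+ 2 = \sum_i frobenius_norm (block Y i) ^+ 2.
Proof.
rewrite sqr_frobenius_norm.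
under [RHS]eq_bigr do rewrite sqr_frobenius_norm.
rewrite (reindex (@tagnat.rank n (fun=> d))) /=; last exact: tagnat.rank_bij_on.
rewrite [RHS](sig_big_dep (J := fun=> 'I_d)) /=.
apply: eq_bigr => -[i k] _; apply: eq_bigr => j _.
by rewrite mxE.
Qed.

Lemma frobenius_norm_stacked (G : set 'M[R]_d) (Y : block_column R n d) :
  closed_subgroup G -> stacked G Y -> frobenius_norm Y ^+ 2 = (n * d)%:R.
Proof.
move=> hG hY; rewrite sqr_frobenius_norm_block.
have h i : frobenius_norm (block Y i) ^+ 2 = d%:R.
  rewrite sqr_frobenius_norm_tr (closed_subgroup_orthogonal hG (hY i)).
  by rewrite mxtrace_scalar.
by under eq_bigr do rewrite h; rewrite sumr_const card_ord natrM mulr_natl.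
Qed.

Lemma frobenius_norm_stacked_map (G : set 'M[R]_d) Pi (X Y : block_column R n d) :
  is_projection G Pi -> stacked G Y ->
  frobenius_norm (stacked_map Pi X - Y) <= 2 * frobenius_norm (X - Y).
Proof.
move=> hPi hY; rewrite frobenius_norm_le // !sqr_frobenius_norm_block mulr_sumr.
apply: ler_sum => i _.
have bB (A B : block_column R n d) : block (A - B) i = block A i - block B i.
  by apply/matrixP => k l; rewrite !mxE.
rewrite !bB -frobenius_norm_le //.
have -> : block (stacked_map Pi X) i = Pi (block X i) by rewrite /block mxcolK.
exact: frobenius_norm_projection.
Qed.

End Blocks.

(** * The estimates on a good graph *)

Section Deterministic.
Context {disp : measure_display} {T : measurableType disp} {R : realType}.
Variable P : probability T R.
Context {n d : nat}.
Variables (w : 'I_n -> 'I_n -> {RV P >-> bool})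
  (Theta : 'I_n -> 'I_n -> 'I_d -> 'I_d -> {RV P >-> R}).
Variables (p tau : R) (k l : nat) (t : T).
Hypotheses (pn_gt0 : 0 < p * n%:R) (tau_ge0 : 0 <= tau) (lk : l = (2 ^ k.+1)%N).
Hypothesis good : good_graph p (observed_graph w t).
Hypothesis trace_le :
  \tr (noise_graph Theta (adjacency (observed_graph w t)) t ^+ l) <= tau ^+ l.

Let deg_ge i : p * n%:R / 4 <= degree w t i.
Proof. by rewrite degree_adjacency; have [_] := good i. Qed.

Let deg_gt0 i : 0 < degree w t i.
Proof. by apply: lt_le_trans (deg_ge i); rewrite divr_gt0. Qed.

Lemma deviation_bound (x : 'cV_(\sum_(i < n) d)) : frobenius_norm x <= 1 ->
  frobenius_norm (deviation w Theta t *m x) <= tau.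
Proof.
move=> x1; rewrite deviation_noise_graph.
have l0 : (0 < l)%N by rewrite lk expn_gt0.
rewrite -(@ler_pXn2r _ l) ?nnegrE ?frobenius_norm_ge0 //; apply: le_trans trace_le.
rewrite lk; apply: frobenius_norm_le_trace => //.
by apply: noise_graph_sym; [exact: adjacency_irr|exact: adjacency_sym].
Qed.

Lemma scaled_deviation_bound (x : 'cV_(\sum_(i < n) d)) : frobenius_norm x <= 1 ->
  frobenius_norm (scaled_deviation w Theta t *m x) <= 4 * tau / (p * n%:R).
Proof.
move=> x1; rewrite /scaled_deviation -mulmxA /degree_mx mul_invmx_mxdiag; last first.
  by move=> i; rewrite gt_eqF.
set y := deviation w Theta t *m x.
have c0 : 0 <= 4 / (p * n%:R) by rewrite divr_ge0 // ltW.
apply: (@le_trans _ _ (4 / (p * n%:R) * frobenius_norm y)).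
  rewrite frobenius_norm_le // !sqr_frobenius_norm mulr_sumr; apply: ler_sum => a _.
  rewrite mulr_sumr; apply: ler_sum => j _; rewrite mxE exprMn.
  rewrite ler_wpM2r ?sqr_ge0 // lerXn2r ?nnegrE ?invr_ge0 ?(ltW (deg_gt0 _)) //.
  by rewrite -[4 / _]invf_div lef_pV2 ?posrE ?divr_gt0.
rewrite mulrAC ler_wpM2r ?invr_ge0 ?(ltW pn_gt0) // ler_wpM2l //.
exact: deviation_bound.
Qed.

(** In the second bound the outer 4 is 2 from the projection times 2 from the perturbation 2 D^-1
    Delta G*. *)
Lemma estimates (G : set 'M[R]_d) (Gstar : block_column R n d) (Pi : 'M[R]_d -> 'M[R]_d) :
  closed_subgroup G -> stacked G Gstar -> is_projection G Pi ->
  operator_norm (scaled_deviation w Theta t) <= 4 * tau / (p * n%:R) /\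
  frobenius_norm (stacked_map Pi
      (Gstar + 2 *: (scaled_deviation w Theta t *m Gstar)) - Gstar) <=
    4 * (4 * tau / (p * n%:R)) * Num.sqrt (n * d)%:R.
Proof.
move=> hG hGs hPi; split; first exact: operator_norm_le scaled_deviation_bound.
have kappa0 : 0 <= 4 * tau / (p * n%:R) by apply: divr_ge0; [exact: mulr_ge0|exact: ltW].
apply: (le_trans (frobenius_norm_stacked_map _ hPi hGs)).
set kappa := 4 * tau / (p * n%:R) in kappa0 *.
rewrite [Gstar + _]addrC addrK frobenius_normZ ger0_norm //.
set r := Num.sqrt _; rewrite (_ : 4 * kappa * r = 2 * (2 * (kappa * r))); last by ring.
rewrite !ler_pM2l //.
apply: (le_trans (frobenius_norm_bound Gstar kappa0 scaled_deviation_bound)).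
rewrite ler_wpM2l // /r -(frobenius_norm_stacked hG hGs) sqrtr_sqr.
by rewrite ger0_norm ?frobenius_norm_ge0.
Qed.

End Deterministic.

Lemma expR1_le4 (R : realType) : expR (1 : R) <= 4.
Proof.
rewrite (_ : 4 = 2 ^+ 2 :> R); last by ring.
rewrite (_ : expR 1 = expR (2^-1 : R) ^+ 2); last by rewrite -expRM_natl divff.
by rewrite lerXn2r ?nnegrE ?expR_ge0 // expR_half_le2.
Qed.

Lemma sqrt2_ge (R : realType) : 1 + 2 / 5 <= Num.sqrt (2 : R).
Proof.
have h : (0 : R) <= 1 + 2 / 5 by lra.
rewrite -[leLHS](ger0_norm h) -sqrtr_sqr ler_sqrt; last exact: ler0n.
lra.
Qed.

Lemma wigner_const_gt0 (R : realType) : 0 < wigner_const :> R.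
Proof. by apply: mulr_gt0; [apply: exprn_gt0; exact: ltr0n|exact: expR_gt0]. Qed.

Theorem theorem4 (R : realType) :
  exists c0 c1 c2 : R, [/\ 0 < c0, 0 < c1, 0 < c2 &
  forall (n d : nat) (G : set 'M[R]_d) (Gstar : block_column R n d)
    (Pi : 'M[R]_d -> 'M[R]_d) (alpha p sigma : R)
    (disp : measure_display) (T : measurableType disp) (P : probability T R)
    (w : 'I_n -> 'I_n -> {RV P >-> bool})
    (Theta : 'I_n -> 'I_n -> 'I_d -> 'I_d -> {RV P >-> R}),
  (0 < n)%N -> (0 < d)%N ->
  closed_subgroup G -> stacked G Gstar -> is_projection G Pi ->
  1 <= alpha -> 0 < p <= 1 -> 0 < sigma ->
  erdos_renyi w p -> sub_gaussian_noise w Theta sigma ->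
  (c0 * (ln n%:R) ^+ 2 / n%:R <= p \/
   (gaussian_noise Theta sigma /\ c0 * ln n%:R / n%:R <= p)) ->
  sigma <= c1 * Num.sqrt (p * n%:R) / (alpha * d%:R) ->
  probability_ge P
    [set t | operator_norm (scaled_deviation w Theta t) <= 1 / 32 /\
      frobenius_norm
        (stacked_map Pi
           (Gstar + 2 *: (scaled_deviation w Theta t *m Gstar)) - Gstar)
      <= (Num.sqrt 2 - 1) * Num.sqrt n%:R / (48 * alpha)]
    (1 - c2 / n%:R)].
Proof.
have [C CE] : {C : R | C = wigner_const} by exists wigner_const.
have [e eE] : {e : R | e = expR 1} by exists (expR 1).
have C0 : 0 < C by rewrite CE; exact: wigner_const_gt0.
have e0 : 0 < e by rewrite eE; exact: expR_gt0.
(* The 48 is 4 * 4 * 3: the degrees, the factor of sigma in the moment bound, and sqrt l <= 3 sqrt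
   (dpn). The 480 is 4 * 48 / (2/5), where 2/5 is a lower bound for sqrt 2 - 1. *)
pose K := 480 * 48 * (e * C).
have K0 : 0 < K.
  by apply: mulr_gt0; [apply: mulr_gt0; exact: ltr0n|exact: mulr_gt0].
(* The degrees require 8. The failure probability is 3/n, and 4 also makes the claim trivial for n
   <= 4; beyond that e <= 4 < n gives ln n >= 1, so (ln n)^2 >= ln n. *)
exists 8, K^-1, 4; split => //; first by rewrite invr_gt0.
move=> n d G Gstar Pi alpha p sigma disp T P w Theta n0 d0 hG hGs hPi al1 p01 s0 er noise hp hs.
have nR0 : (0 : R) < n%:R by rewrite ltr0n.
have dR1 : (1 : R) <= d%:R by rewrite ler1n.
have dR0 : (0 : R) < d%:R by rewrite ltr0n.
have al0 : 0 < alpha by lra.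
have [n4|n4] := leqP n 4.
  exists set0 => //; split => //; rewrite measure0 lee_fin subr_le0 ler_pdivlMr // mul1r.
  by rewrite (ler_nat _ _ 4).
have /andP[p0 p1] := p01.
set L : R := ln n%:R.
have eL : expR L = n%:R by rewrite lnK ?posrE.
have L1 : 1 <= L.
  rewrite -ler_expR eL (le_trans (expR1_le4 R)) // (ler_nat _ 4).
  exact: ltnW.
set pn := p * n%:R.
have pnL : 8 * L <= pn.
  case: hp => [|[_]]; rewrite ler_pdivrMr // -/pn -/L => h //.
  have : L <= L ^+ 2 by rewrite expr2 ler_peMl //; lra.
  lra.
have pn0 : 0 < pn by lra.
(* An integer bound for the degrees; truncation loses less than 1 <= pn, whence the lower bound
   3pn. *)
set B := Num.truncn (4 * pn).
have [B1 B2] : (B%:R : R) <= 4 * pn /\ 3 * pn <= B%:R.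
  have /andP[h1 h2] : B%:R <= 4 * pn < B.+1%:R by apply: truncn_itv; lra.
  by split => //; move: h2; rewrite -natr1; lra.
(* [M] bounds the degrees of the graph on nd vertices, and [l] is a power of 2 between [M] and 2M;
   hence 3dpn <= l <= 8dpn. *)
set M := (B * d)%N; pose k := trunc_log 2 M.
have M0 : (0 < M)%N.
  rewrite muln_gt0 d0 andbT -(ltr0n R); lra.
pose l := (2 ^ k.+1)%N.
have Ml : (M <= l)%N by exact/ltnW/trunc_log_ltn.
have lM : (l <= 2 * M)%N by rewrite /l expnS leq_pmul2l // trunc_logP.
have l0 : (0 < l)%N by rewrite expn_gt0.
have lR : (l%:R : R) <= 8 * (d%:R * pn).
  apply: (@le_trans _ _ (2 * (B%:R * d%:R))); first by rewrite -!natrM ler_nat.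
  have : B%:R * d%:R <= 4 * pn * d%:R by rewrite ler_wpM2r // ltW.
  lra.
have lR' : 3 * pn * d%:R <= (l%:R : R).
  apply: (@le_trans _ _ (B%:R * d%:R)); first by rewrite ler_wpM2r // ltW.
  by rewrite -natrM ler_nat.
set s : R := 4 * sigma * (C * Num.sqrt l%:R).
have sp : 0 < s by rewrite /s !mulr_gt0 // sqrtr_gt0 ltr0n.
(* The extra factor e over the moment scale [s] makes Markov's inequality gain e^-l. *)
pose tau := e * s.
have tau0 : 0 < tau by rewrite mulr_gt0.
pose S om := [set t | \tr (noise_graph Theta (adjacency om) t ^+ l) <= tau ^+ l].
have aS om : all_noise_sigma Theta (S om).
  by apply: noise_trace_adapted; exact: adjacency_irr.
have mS om : measurable (S om).
  rewrite -[X in measurable X]setTI; apply: measurable_fun_le => //.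
  by apply: noise_trace_measurable; exact: adjacency_irr.
have PS om : good_graph p om -> ((1 - 1 / n%:R)%:E <= P (S om))%E.
  move=> good.
  have deg i : (#|adjacency om i| * d <= l)%N.
    apply: leq_trans Ml; rewrite /M leq_mul2r; apply/orP; right.
    rewrite /B truncn_ge_nat //; last by lra.
    by have [] := good i.
  have := noise_trace_tail s0 noise (adjacency_irr om) (adjacency_sym om) (erefl l) (exprn_gt0 l tau0) deg.
  apply: le_trans; rewrite lee_fin lerD2l lerN2 -CE -/s /tau [(e * s) ^+ l]exprMn.
  have -> : (\sum_(i < n) d)%:R * (2 * s ^+ l) / (e ^+ l * s ^+ l) =
      2 * (n%:R * d%:R) / e ^+ l :> R.
    rewrite sum_nat_const card_ord natrM; field.
    by rewrite !expf_neq0 // gt_eqF.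
  rewrite ler_pdivrMr ?exprn_gt0 // mulrAC mul1r ler_pdivlMr //.
  rewrite eE -expRM_natl mulr1.
  have h1 : 2 <= expR (1 : R) by have := expR_ge1Dx (1 : R); lra.
  have h2 : d%:R <= expR (d%:R : R) by have := expR_ge1Dx (d%:R : R); lra.
  (* The prefactor 2nd times n is at most exp (1 + 2L + d), and l >= 3dpn >= 24 L d exceeds this
     exponent. *)
  apply: (@le_trans _ _ (expR 1 * (expR L * expR d%:R) * expR L)).
    rewrite eL ler_pM2r //.
    by apply: ler_pM; rewrite ?mulr_ge0 ?(ltW nR0) ?(ltW dR0) // ler_pM2l.
  rewrite -!expRD ler_expR; apply: le_trans lR'.
  have : 8 * L * d%:R <= pn * d%:R by rewrite ler_wpM2r // ltW.
  have : 1 * d%:R <= L * d%:R by rewrite ler_wpM2r // ltW.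
  have : L * 1 <= L * d%:R by rewrite ler_wpM2l //; lra.
  lra.
have nn : 0 <= (1 / n%:R : R) <= 1.
  by rewrite divr_ge0 ?(ltW nR0) //= ler_pdivrMr // mul1r ler1n.
have n20 : 0 <= (2 / n%:R : R) by rewrite divr_ge0 // ltW.
have [mE PE] := conditional_event noise n20 nn mS aS PS (good_graph_probability p01 er n0 pnL).
exists [set t | good_graph p (observed_graph w t) /\ S (observed_graph w t) t] => //.
split; last first.
  apply: le_trans PE; rewrite lee_fin lerD2l lerN2 -mulrDl ler_pM2r ?invr_gt0 //.
  lra.
move=> t [good trle] /=.
have [h1 h2] := estimates pn0 (ltW tau0) (erefl l) good trle hG hGs hPi.
set kappa := 4 * tau / (p * n%:R) in h1 h2.
set q : R := Num.sqrt pn; set r : R := Num.sqrt d%:R.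
have q0 : 0 < q by rewrite sqrtr_gt0.
have r0 : 0 < r by rewrite sqrtr_gt0.
have qq : q ^+ 2 = pn by rewrite sqr_sqrtr // ltW.
have rr : r ^+ 2 = d%:R by rewrite sqr_sqrtr // ltW.
have r1 : 1 <= r by rewrite -(@ler_pXn2r _ 2) ?nnegrE ?(ltW r0) // expr1n rr.
(* From l <= 8dpn <= 9dpn. *)
have sl : Num.sqrt l%:R <= 3 * (r * q).
  rewrite -(@ler_pXn2r _ 2) ?nnegrE ?sqrtr_ge0 ?mulr_ge0 ?(ltW r0) ?(ltW q0) //.
  rewrite sqr_sqrtr // !exprMn qq rr.
  have : 0 <= d%:R * pn by rewrite mulr_ge0 // ltW.
  lra.
have taule : tau <= e * (4 * (K^-1 * q / (alpha * d%:R)) * (C * (3 * (r * q)))).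
  rewrite ler_wpM2l ?(ltW e0) //; apply: ler_pM; rewrite ?mulr_ge0 ?sqrtr_ge0 ?(ltW s0) ?(ltW C0) //.
    by rewrite ler_wpM2l.
  by rewrite ler_wpM2l // ltW.
(* The assumption on sigma divides by d while sqrt l only brings sqrt d, so a factor 1 / sqrt d is
   left over; it cancels the sqrt d of the norm of G* below. *)
have kle : kappa <= (480 * (alpha * r))^-1.
  rewrite /kappa ler_pdivrMr // -/pn.
  have -> : (480 * (alpha * r))^-1 * pn =
      4 * (e * (4 * (K^-1 * q / (alpha * d%:R)) * (C * (3 * (r * q))))).
    rewrite -qq -rr /K; field.
    by rewrite !gt_eqF.
  by rewrite ler_wpM2l.
have alr : 1 <= alpha * r by rewrite -[1]mulr1; apply: ler_pM.
split.
  apply: (le_trans h1); apply: (le_trans kle).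
  by rewrite div1r lef_pV2 ?posrE; [lra|lra|exact: ltr0n].
apply: (le_trans h2).
have sq2 := sqrt2_ge R.
have snd : Num.sqrt (n * d)%:R = Num.sqrt n%:R * r :> R by rewrite natrM sqrtrM // ltW.
have sn0 : 0 <= (Num.sqrt n%:R : R) by exact: sqrtr_ge0.
rewrite snd.
apply: (@le_trans _ _ (4 * (480 * (alpha * r))^-1 * (Num.sqrt n%:R * r))).
  by rewrite ler_wpM2r ?mulr_ge0 ?(ltW r0) // ler_wpM2l.
have -> : 4 * (480 * (alpha * r))^-1 * (Num.sqrt n%:R * r) = 2 / 5 * Num.sqrt n%:R / (48 * alpha).
  by field; rewrite !gt_eqF.
rewrite ler_wpM2r ?invr_ge0 ?mulr_ge0 ?(ltW al0) // ler_wpM2r //; lra.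
Qed.
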